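(* Let $H=(\{H_\alpha\},\Delta,\epsilon,S,\varphi,R)$ be a quasitriangular Hopf $\pi$-coalgebra with Drinfeld elements $u_\alpha$ ($\alpha\in\pi$). For any $\alpha,\beta\in\pi$: (a) $u_\alpha$ is invertible and $u_\alpha^{-1}=m_\alpha(\mathrm{id}_{H_\alpha}\otimes S_{\alpha^{-1}}S_\alpha)\sigma_{\alpha,\alpha}(R_{\alpha,\alpha})$; (b) $S_{\alpha^{-1}}S_\alpha(\varphi_\alpha(x))=u_\alpha xu_\alpha^{-1}$ for all $x\in H_\alpha$; (c) the antipode of $H$ is bijective, i.e. each $S_\alpha$ is bijective; (d) $\varphi_\beta(u_\alpha)=u_{\beta\alpha\beta^{-1}}$; (e) $S_{\alpha^{-1}}(u_{\alpha^{-1}})u_\alpha=u_\alpha S_{\alpha^{-1}}(u_{\alpha^{-1}})$, and this element, denoted $c_\alpha$, satisfies $c_\alpha\varphi_{\alpha^{-1}}(x)=\varphi_\alpha(x)c_\alpha$ for all $x\in H_\alpha$; (f) $\Delta_{\alpha,\beta}(u_{\alpha\beta})=[\sigma_{\beta,\alpha}(\mathrm{id}_{H_\beta}\otimes\varphi_\alpha)(R_{\beta,\alpha})\cdot R_{\alpha,\beta}]^{-1}\cdot(u_\alpha\otimes u_\beta)=(u_\alpha\otimes u_\beta)\cdot[\sigma_{\beta,\alpha}(\varphi_{\beta^{-1}}\otimes\mathrm{id}_{H_\alpha})(R_{\beta,\alpha})\cdot(\varphi_{\alpha^{-1}}\otimes\varphi_{\beta^{-1}})(R_{\alpha,\beta})]^{-1}$;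 (g) $\epsilon(u_1)=1$.
   Context: Throughout, $\pi$ is a discrete group with neutral element $1$, $\Bbbk$ is a field, $\otimes=\otimes_\Bbbk$, and algebras are associative and unital over $\Bbbk$ (the zero algebra is allowed). A $\pi$-coalgebra is a family $C=\{C_\alpha\}_{\alpha\in\pi}$ of $\Bbbk$-spaces with $\Bbbk$-linear maps $\Delta_{\alpha,\beta}:C_{\alpha\beta}\to C_\alpha\otimes C_\beta$ and $\epsilon:C_1\to\Bbbk$ such that $(\Delta_{\alpha,\beta}\otimes\mathrm{id}_{C_\gamma})\Delta_{\alpha\beta,\gamma}=(\mathrm{id}_{C_\alpha}\otimes\Delta_{\beta,\gamma})\Delta_{\alpha,\beta\gamma}$ and $(\mathrm{id}_{C_\alpha}\otimes\epsilon)\Delta_{\alpha,1}=\mathrm{id}_{C_\alpha}=(\epsilon\otimes\mathrm{id}_{C_\alpha})\Delta_{1,\alpha}$ for all $\alpha,\beta,\gamma\in\pi$. A Hopf $\pi$-coalgebra is a $\pi$-coalgebra $H=(\{H_\alpha\},\Delta,\epsilon)$ with $\Bbbk$-linear maps $S_\alpha:H_\alpha\to H_{\alpha^{-1}}$ (the antipode, not assumed bijective) such that each $H_\alpha$ is an algebra with multiplication $m_\alpha$ and unit $1_\alpha$, the maps $\epsilon$ and all $\Delta_{\alpha,\beta}$ are algebra homomorphisms, and $m_\alpha(S_{\alpha^{-1}}\otimes\mathrm{id}_{H_\alpha})\Delta_{\alpha^{-1},\alpha}=\epsilon 1_\alpha=m_\alpha(\mathrm{id}_{H_\alpha}\otimes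 S_{\alpha^{-1}})\Delta_{\alpha,\alpha^{-1}}$ for all $\alpha$. A crossed Hopf $\pi$-coalgebra is one endowed with a crossing: $\Bbbk$-linear maps $\varphi_\beta:H_\alpha\to H_{\beta\alpha\beta^{-1}}$ ($\alpha,\beta\in\pi$) that are algebra isomorphisms with $(\varphi_\beta\otimes\varphi_\beta)\Delta_{\alpha,\gamma}=\Delta_{\beta\alpha\beta^{-1},\beta\gamma\beta^{-1}}\varphi_\beta$, $\epsilon\varphi_\beta=\epsilon$, and $\varphi_{\beta\beta'}=\varphi_\beta\varphi_{\beta'}$. Let $\sigma_{\beta,\alpha}:H_\beta\otimes H_\alpha\to H_\alpha\otimes H_\beta$ be the flip. A quasitriangular Hopf $\pi$-coalgebra is a crossed one with invertible elements $R_{\alpha,\beta}\in H_\alpha\otimes H_\beta$ ($\alpha,\beta\in\pi$) such that for all $\alpha,\beta,\gamma\in\pi$: (i) $R_{\alpha,\beta}\cdot\Delta_{\alpha,\beta}(x)=\sigma_{\beta,\alpha}(\varphi_{\alpha^{-1}}\otimes\mathrm{id}_{H_\alpha})\Delta_{\alpha\beta\alpha^{-1},\alpha}(x)\cdot R_{\alpha,\beta}$ for all $x\in H_{\alpha\beta}$; (ii) $(\mathrm{id}_{H_\alpha}\otimes\Delta_{\beta,\gamma})(R_{\alpha,\beta\gamma})=(R_{\alpha,\gamma})_{1\beta3}\cdot(R_{\alpha,\beta})_{12\gamma}$ and $(\Delta_{\alpha,\beta}\otimes\mathrm{id}_{H_\gamma})(R_{\alpha\beta,\gamma})=[(\mathrm{id}_{H_\alpha}\otimes\varphi_{\beta^{-1}})(R_{\alpha,\beta\gamma\beta^{-1}})]_{1\beta3}\cdot(R_{\beta,\gamma})_{\alpha23}$,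 where for $r=\sum_jp_j\otimes q_j$ one sets $r_{12\gamma}=r\otimes1_\gamma$, $r_{\alpha23}=1_\alpha\otimes r$, $r_{1\beta3}=\sum_jp_j\otimes1_\beta\otimes q_j$; (iii) $(\varphi_\beta\otimes\varphi_\beta)(R_{\alpha,\gamma})=R_{\beta\alpha\beta^{-1},\beta\gamma\beta^{-1}}$. The Drinfeld elements of $H$ are $u_\alpha=m_\alpha(S_{\alpha^{-1}}\varphi_\alpha\otimes\mathrm{id}_{H_\alpha})\sigma_{\alpha,\alpha^{-1}}(R_{\alpha,\alpha^{-1}})\in H_\alpha$, $\alpha\in\pi$. *)

(* Defs.v *)
From HB Require Import structures.
From mathcomp Require Import all_boot all_order all_algebra.
From mathcomp Require Import generic_quotient ring_quotient sesquilinear.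
From mathcomp Require Import boolp.
From mathcomp Require Import freeg.

Set Implicit Arguments.
Unset Strict Implicit.
Unset Printing Implicit Defensive.

Import GRing.Theory.
Local Open Scope ring_scope.
Local Open Scope quotient_scope.

(* Associative unital algebras, possibly zero ([algType] requires 1 != 0): the
   product [x * y] and the unit [1] are those of the multiplicative monoid
   structure, hence live in [group_scope]. *)
HB.mixin Record isBilinearMonoid (R : pzRingType) A
    of Monoid A & GRing.Lmodule R A := {
  amulDl : forall x y z : A, ((x + y)%R * z)%g = (x * z)%g + (y * z)%g;
  amulDr : forall x y z : A, (x * (y + z)%R)%g = (x * y)%g + (x * z)%g;
  ascalerAl : forall (c : R) (x y : A), c *: (x * y)%g = ((c *: x)%R * y)%g;
  ascalerAr : forall (c : R) (x y : A), c *: (x * y)%g = (x * (c *: y)%R)%g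
}.

#[short(type="unitalAlgType")]
HB.structure Definition UnitalAlg (R : pzRingType) :=
  {A of Monoid A & GRing.Lmodule R A & isBilinearMonoid R A}.

(* [minv x] is the junk value [x] if [x] is not invertible. *)
Section Inverse.
Variable A : monoidType.
Local Open Scope group_scope.

Definition inverse_of (x y : A) := x * y = 1 /\ y * x = 1.

Definition invertible (x : A) := exists y, inverse_of x y.

Definition minv (x : A) : A :=
  if pselect (invertible x) is left h then projT1 (cid h) else x.

Lemma minvP x : invertible x -> inverse_of x (minv x).
Proof. by move=> h; rewrite /minv; case: pselect => // h'; case: cid. Qed.

Lemma minvE x y : inverse_of x y -> minv x = y.
Proof.
move=> [xy yx]; have [|_ rx] := minvP (x := x); first by exists y.
by rewrite -[LHS]mulg1 -xy mulgA rx mul1g.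
Qed.
End Inverse.

(* The tensor product over a field: the free module on U * V modulo the
   submodule generated by the bilinearity relations. *)
Section TensorDef.
Variables (k : fieldType) (U V : lmodType k).

Local Notation F := {freeg (U * V)%type / k}.

Definition submod_prop (M : lmodType k) (P : M -> Prop) :=
  P 0 /\ forall (c : k) x y, P x -> P y -> P (c *: x + y).

Definition tens_relators (P : F -> Prop) :=
  (forall (c : k) (u u' : U) (v : V),
    P (<< (c *: u + u', v) >> - (c *: << (u, v) >> + << (u', v) >>))) /\
  (forall (c : k) (u : U) (v v' : V),
    P (<< (u, c *: v + v') >> - (c *: << (u, v) >> + << (u, v') >>))).

Definition tens_ideal : {pred F} := fun x : F =>
  `[< forall P : F -> Prop, submod_prop P -> tens_relators P -> P x >].

Lemma tens_ideal_zmod : zmod_closed tens_ideal.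
Proof.
split=> [|x y /asboolP hx /asboolP hy]; apply/asboolP => P sP rP.
  by case: sP.
have -> : x - y = (-1) *: y + x by rewrite scaleN1r addrC.
by case: (sP) => _; apply; [exact: hy | exact: hx].
Qed.

HB.instance Definition _ := GRing.isZmodClosed.Build F tens_ideal
  tens_ideal_zmod.

Lemma tens_idealZ (c : k) x : x \in tens_ideal -> c *: x \in tens_ideal.
Proof.
move=> /asboolP hx; apply/asboolP => P sP rP.
by rewrite -[_ *: _]addr0; case: (sP) => P0; apply => //; exact: hx.
Qed.

Definition tensor := Quotient.quot tens_ideal.

HB.instance Definition _ := GRing.Zmodule.on tensor.

Definition tpi (x : F) : tensor := \pi_tensor x.

Lemma tpi_eq x y : (x - y \in tens_ideal) -> tpi x = tpi y.
Proof.
by rewrite (Quotient.idealrBE (tens_ideal : zmodClosed F)) => /eqP.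
Qed.

Lemma tpi_eq0 x : tpi x = 0 -> x \in tens_ideal.
Proof.
move=> h; rewrite -[x]subr0 (Quotient.idealrBE (tens_ideal : zmodClosed F)).
apply/eqP; rewrite -[LHS]/(tpi x) h.
by rewrite [RHS](raddf0 (\pi_tensor : {additive F -> tensor})).
Qed.

Lemma tpiB : {morph tpi : x y / x - y}.
Proof. exact: (raddfB (\pi_tensor : {additive F -> tensor})). Qed.
Lemma tpiD : {morph tpi : x y / x + y}.
Proof. exact: (raddfD (\pi_tensor : {additive F -> tensor})). Qed.

Lemma tpiK x : tpi (repr x) = x. Proof. exact: reprK. Qed.

Definition tscale (c : k) (x : tensor) : tensor := tpi (c *: repr x).

Lemma tpiZ c x : tpi (c *: x) = tscale c (tpi x).
Proof.
apply: tpi_eq; rewrite -scalerBr; apply: tens_idealZ.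
by apply: tpi_eq0; rewrite tpiB tpiK subrr.
Qed.

Fact tscaleA a b x : tscale a (tscale b x) = tscale (a * b) x.
Proof. by rewrite -[x]tpiK -!tpiZ scalerA. Qed.
Fact tscale1 : left_id 1 tscale.
Proof. by move=> x; rewrite -[x]tpiK -!tpiZ scale1r. Qed.
Fact tscaleDr : right_distributive tscale +%R.
Proof.
by move=> c x y; rewrite -[x]tpiK -[y]tpiK -tpiD -!tpiZ scalerDr tpiD.
Qed.
Fact tscaleDl x : {morph tscale^~ x : a b / a + b}.
Proof. by move=> a b /=; rewrite -[x]tpiK -!tpiZ scalerDl tpiD. Qed.

HB.instance Definition _ := GRing.Zmodule_isLmodule.Build k tensor
  tscaleA tscale1 tscaleDr tscaleDl.

Fact tpi_linear : linear tpi.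
Proof. by move=> c x y; rewrite tpiD tpiZ. Qed.

Definition tens (u : U) (v : V) : tensor := tpi << (u, v) >>.

Fact tens_bilinear : bilinear_for *:%R *:%R tens.
Proof.
split=> [v c u u'|u c v v']; rewrite /tens -tpi_linear;
  apply: tpi_eq; apply/asboolP => P _ [hl hr]; [exact: hl | exact: hr].
Qed.

HB.instance Definition _ :=
  bilinear_isBilinear.Build k U V tensor *:%R *:%R tens tens_bilinear.

Lemma tensPl v (c : k) u u' :
  tens (c *: u + u') v = c *: tens u v + tens u' v.
Proof. by case: tens_bilinear => h _; exact: h. Qed.

Lemma tensPr u (c : k) v v' :
  tens u (c *: v + v') = c *: tens u v + tens u v'.
Proof. by case: tens_bilinear => _ h; exact: h. Qed.

Lemma freeg_ind (P : F -> Prop) :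
  submod_prop P -> (forall x, P << x >>) -> forall x, P x.
Proof.
move=> [P0 PD] Pu x; rewrite -[x]freeg_sumE.
elim: (dom x) => [|y s IHs]; first by rewrite big_nil.
rewrite big_cons; have -> : << coeff y x *g y >> = coeff y x *: << y >> :> F.
  by apply/eqP/freeg_eqP => z; rewrite coeffZ !coeffU mul1r.
exact: PD.
Qed.

Lemma tensor_ind (P : tensor -> Prop) :
  submod_prop P -> (forall u v, P (tens u v)) -> forall x, P x.
Proof.
move=> [P0 PD] Pt x; rewrite -[x]tpiK; elim/freeg_ind: (repr x) => [|[u v]].
  split=> [|c y z Py Pz]; first by rewrite -[0 : F](subrr 0) tpiB subrr.
  by rewrite tpi_linear; apply: PD.
exact: Pt.
Qed.

Section Lift.
Variables (W : lmodType k) (b : {bilinear U -> V -> W}).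

Definition tens_prelift (x : F) : W := fglift (fun p : U * V => b p.1 p.2) x.

Fact tens_prelift_linear : linear tens_prelift.
Proof.
have preliftB : {morph tens_prelift : x y / x - y} by exact: lift_is_additive.
have prelift0 : tens_prelift 0 = 0 by rewrite -(subrr 0) preliftB subrr.
have preliftN x : tens_prelift (- x) = - tens_prelift x.
  by rewrite -[- x]add0r preliftB prelift0 add0r.
have preliftD x y : tens_prelift (x + y) = tens_prelift x + tens_prelift y.
  by rewrite -[y in LHS]opprK preliftB preliftN opprK.
move=> c x y; rewrite preliftD; congr (_ + _).
have sumE (I : seq (U * V)%type) (E : U * V -> F) :
    tens_prelift (\sum_(i <- I) E i) = \sum_(i <- I) tens_prelift (E i).
  by elim: I => [|i I IH]; rewrite ?big_nil // !big_cons preliftD IH.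
rewrite -[x in RHS]freeg_sumE [c *: x]/(fgscale c x) /fgscale !sumE.
rewrite scaler_sumr; apply: eq_bigr => i _.
by rewrite /tens_prelift !liftU scalerA.
Qed.

HB.instance Definition _ :=
  GRing.isLinear.Build k F W *:%R tens_prelift tens_prelift_linear.

Lemma tens_prelift_ideal x : x \in tens_ideal -> tens_prelift x = 0.
Proof.
have preliftU u v : tens_prelift << (u, v) >> = b u v.
  by rewrite /tens_prelift liftU scale1r.
move=> /asboolP /(_ (fun y => tens_prelift y = 0)); apply.
  by split=> [|c y z hy hz]; rewrite ?linear0 // linearP /= hy hz scaler0 addr0.
by split=> [c u u' v|c u v v']; rewrite linearB linearP /= !preliftU
  ?linearPl ?linearPr subrr.
Qed.

Definition tlift (x : tensor) : W := tens_prelift (repr x).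

Lemma tlift_tpi x : tlift (tpi x) = tens_prelift x.
Proof.
apply/eqP; rewrite -subr_eq0 -linearB; apply/eqP.
by apply: tens_prelift_ideal; apply: tpi_eq0; rewrite tpiB tpiK subrr.
Qed.

Fact tlift_linear : linear tlift.
Proof.
move=> c x y; rewrite -[x]tpiK -[y]tpiK -tpi_linear !tlift_tpi.
exact: tens_prelift_linear.
Qed.

HB.instance Definition _ :=
  GRing.isLinear.Build k tensor W *:%R tlift tlift_linear.

Lemma tliftE u v : tlift (tens u v) = b u v.
Proof. by rewrite tlift_tpi /tens_prelift liftU scale1r. Qed.

End Lift.

Lemma tensor_linear_ext (W : lmodType k) (f g : {linear tensor -> W}) :
  (forall u v, f (tens u v) = g (tens u v)) -> f =1 g.
Proof.
move=> fg; apply: tensor_ind => //; split=> [|c x y fx fy].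
  by rewrite !linear0.
by rewrite !linearP fx fy.
Qed.

End TensorDef.

Arguments tens {k U V} u v.

Fact bilinearI (k : fieldType) (U V W : lmodType k) (f : U -> V -> W) :
  (forall v (c : k) u u', f (c *: u + u') v = c *: f u v + f u' v) ->
  (forall u (c : k) v v', f u (c *: v + v') = c *: f u v + f u v') ->
  bilinear_for *:%R *:%R f.
Proof. by []. Qed.

Section TensorMaps.
Variable k : fieldType.
Implicit Types U V W : lmodType k.

Section Map.
Variables (U U' V V' : lmodType k).
Variables (f : {linear U -> U'}) (g : {linear V -> V'}).

Definition tmap_bil (u : U) (v : V) : tensor U' V' := tens (f u) (g v).

Fact tmap_bilinear : bilinear_for *:%R *:%R tmap_bil.
Proof.
by apply: bilinearI => [v c u u'|u c v v']; rewrite /tmap_bil linearP ?tensPl ?tensPr.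
Qed.

HB.instance Definition _ := bilinear_isBilinear.Build k U V (tensor U' V')
  *:%R *:%R tmap_bil tmap_bilinear.

Definition tmap : {linear tensor U V -> tensor U' V'} := tlift tmap_bil.

Lemma tmapE u v : tmap (tens u v) = tens (f u) (g v).
Proof. exact: tliftE. Qed.
End Map.

Section Flip.
Variables U V : lmodType k.

Definition tflip_bil (u : U) (v : V) : tensor V U := tens v u.

Fact tflip_bilinear : bilinear_for *:%R *:%R tflip_bil.
Proof.
by apply: bilinearI => [v c u u'|u c v v']; rewrite /tflip_bil ?tensPl ?tensPr.
Qed.

HB.instance Definition _ := bilinear_isBilinear.Build k U V (tensor V U)
  *:%R *:%R tflip_bil tflip_bilinear.

Definition tflip : {linear tensor U V -> tensor V U} := tlift tflip_bil.

Lemma tflipE u v : tflip (tens u v) = tens v u.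
Proof. exact: tliftE. Qed.
End Flip.

Section Tens.
Variables U V : lmodType k.

Definition tensr (v : V) (u : U) : tensor U V := tens u v.

Fact tensr_linear (v : V) : linear (tensr v).
Proof. by move=> c u u'; rewrite /tensr tensPl. Qed.

HB.instance Definition _ (v : V) := GRing.isLinear.Build k U (tensor U V)
  *:%R (tensr v) (tensr_linear v).

Definition tensl (u : U) (v : V) : tensor U V := tens u v.

Fact tensl_linear (u : U) : linear (tensl u).
Proof. by move=> c v v'; rewrite /tensl tensPr. Qed.

HB.instance Definition _ (u : U) := GRing.isLinear.Build k V (tensor U V)
  *:%R (tensl u) (tensl_linear u).

End Tens.

Section Assoc.
Variables U V W : lmodType k.

Definition tassoc_bil (x : tensor U V) (w : W) : tensor U (tensor V W) :=
  tmap idfun (tensr w) x.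

Fact tassoc_bilinear : bilinear_for *:%R *:%R tassoc_bil.
Proof.
apply: bilinearI => [w c x y|x c w w']; rewrite /tassoc_bil; first exact: linearP.
elim/tensor_ind: x => [|u v].
  split=> [|d x y hx hy]; first by rewrite !linear0 addr0.
  by rewrite !linearP /= hx hy !scalerDr !scalerA [d * c]mulrC addrACA.
by rewrite !tmapE /= /tensr !tensPr.
Qed.

HB.instance Definition _ := bilinear_isBilinear.Build k (tensor U V) W
  (tensor U (tensor V W)) *:%R *:%R tassoc_bil tassoc_bilinear.

Definition tassoc : {linear tensor (tensor U V) W -> tensor U (tensor V W)} :=
  tlift tassoc_bil.

Lemma tassocE u v w : tassoc (tens (tens u v) w) = tens u (tens v w).
Proof. by rewrite [LHS]tliftE [LHS]tmapE. Qed.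
End Assoc.

Section Unitors.
Variable V : lmodType k.

Definition tunitl_bil (c : k^o) (v : V) : V := c *: v.

Fact tunitl_bilinear : bilinear_for *:%R *:%R tunitl_bil.
Proof.
apply: bilinearI => [v c x y|x c v v']; rewrite /tunitl_bil.
  by rewrite scalerDl scalerA.
by rewrite scalerDr !scalerA mulrC.
Qed.

HB.instance Definition _ := bilinear_isBilinear.Build k k^o V V
  *:%R *:%R tunitl_bil tunitl_bilinear.

Definition tunitl : {linear tensor k^o V -> V} := tlift tunitl_bil.

Lemma tunitlE (c : k^o) v : tunitl (tens c v) = c *: v.
Proof. exact: tliftE. Qed.

Definition tunitr : {linear tensor V k^o -> V} := tunitl \o tflip V k^o.

Lemma tunitrE v (c : k^o) : tunitr (tens v c) = c *: v.
Proof. by rewrite /tunitr /= tflipE tunitlE. Qed.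
End Unitors.
End TensorMaps.

Arguments tflip {k U V}.
Arguments tassoc {k U V W}.
Arguments tunitl {k V}.
Arguments tunitr {k V}.

Section AlgebraMult.
Variables (k : fieldType) (A : unitalAlgType k).

Definition amul_bil (x y : A) : A := (x * y)%g.

Fact amul_bilinear : bilinear_for *:%R *:%R amul_bil.
Proof.
apply: bilinearI => [z c x y|x c y z]; rewrite /amul_bil.
  by rewrite amulDl ascalerAl.
by rewrite amulDr ascalerAr.
Qed.

HB.instance Definition _ := bilinear_isBilinear.Build k A A A
  *:%R *:%R amul_bil amul_bilinear.

Definition amul_map : {linear tensor A A -> A} := tlift amul_bil.

Lemma amul_mapE x y : amul_map (tens x y) = (x * y)%g.
Proof. exact: tliftE. Qed.

Definition lmulg (x y : A) : A := (x * y)%g.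

Fact lmulg_linear x : linear (lmulg x).
Proof. by move=> c y z; rewrite /lmulg amulDr ascalerAr. Qed.

HB.instance Definition _ (x : A) :=
  GRing.isLinear.Build k A A *:%R (lmulg x) (lmulg_linear x).
End AlgebraMult.

Section TensorAlgebra.
Variables (k : fieldType) (A B : unitalAlgType k).
Local Notation T := (tensor A B).

Definition tmul_bil (z : T) (a : A) (b : B) : T := tmap (lmulg a) (lmulg b) z.

Fact tmul_bilinear z : bilinear_for *:%R *:%R (tmul_bil z).
Proof.
rewrite /tmul_bil; apply: bilinearI => [b c a a'|a c b b'].
  elim/tensor_ind: z => [|x y].
    split=> [|d x y hx hy]; first by rewrite !linear0 addr0.
    by rewrite !linearP /= hx hy !scalerDr !scalerA [d * c]mulrC addrACA.
  by rewrite !tmapE /= /lmulg amulDl -ascalerAl tensPl.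
elim/tensor_ind: z => [|x y].
  split=> [|d x y hx hy]; first by rewrite !linear0 addr0.
  by rewrite !linearP /= hx hy !scalerDr !scalerA [d * c]mulrC addrACA.
by rewrite !tmapE /= /lmulg amulDl -ascalerAl tensPr.
Qed.

HB.instance Definition _ z := bilinear_isBilinear.Build k A B T
  *:%R *:%R (tmul_bil z) (tmul_bilinear z).

Definition tmul (x y : T) : T := tlift (tmul_bil y) x.

Lemma tmulE a b a' b' :
  tmul (tens a b) (tens a' b') = tens (a * a')%g (b * b')%g.
Proof. by rewrite /tmul tliftE [LHS]tmapE. Qed.

Lemma tmulPl z c x y : tmul (c *: x + y) z = c *: tmul x z + tmul y z.
Proof. exact: linearP. Qed.

Lemma tmulPr z c x y : tmul z (c *: x + y) = c *: tmul z x + tmul z y.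
Proof.
elim/tensor_ind: z => [|a b].
  split=> [|d u v hu hv]; first by rewrite /tmul !linear0 addr0.
  by rewrite !tmulPl hu hv !scalerDr !scalerA [d * c]mulrC addrACA.
have tmulT t : tmul (tens a b) t = tmap (lmulg a) (lmulg b) t.
  exact: tliftE.
by rewrite !tmulT linearP.
Qed.

Lemma tmul0l x : tmul 0 x = 0. Proof. exact: linear0. Qed.
Lemma tmul0r x : tmul x 0 = 0.
Proof. by have := tmulPr x (-1) 0 0; rewrite scaler0 addr0 scaleN1r addNr. Qed.

Fact tmulA : associative tmul.
Proof.
move=> x y z; elim/tensor_ind: x => [|a b].
  by split=> [|c x x' hx hx']; rewrite ?tmul0l // !tmulPl hx hx'.
elim/tensor_ind: y => [|a' b'].
  by split=> [|c y y' hy hy']; rewrite ?(tmul0l, tmul0r) //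
    !(tmulPl, tmulPr) hy hy'.
elim/tensor_ind: z => [|a'' b''].
  by split=> [|c y y' hy hy']; rewrite ?(tmul0l, tmul0r) //
    !(tmulPl, tmulPr) hy hy'.
by rewrite !tmulE !mulgA.
Qed.

Fact tmul1l : left_id (tens 1%g 1%g) tmul.
Proof.
move=> x; elim/tensor_ind: x => [|a b]; last by rewrite tmulE !mul1g.
by split=> [|c x y hx hy]; rewrite ?tmul0r // tmulPr hx hy.
Qed.

Fact tmul1r : right_id (tens 1%g 1%g) tmul.
Proof.
move=> x; elim/tensor_ind: x => [|a b]; last by rewrite tmulE !mulg1.
by split=> [|c x y hx hy]; rewrite ?tmul0l // tmulPl hx hy.
Qed.

HB.instance Definition _ := isMonoid.Build T tmulA tmul1l tmul1r.

Fact tmulDl (x y z : T) : ((x + y)%R * z)%g = (x * z)%g + (y * z)%g :> T.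
Proof. by have := tmulPl z 1 x y; rewrite !scale1r. Qed.
Fact tmulDr (x y z : T) : (x * (y + z)%R)%g = (x * y)%g + (x * z)%g :> T.
Proof. by have := tmulPr x 1 y z; rewrite !scale1r. Qed.
Fact tscaleAl c (x y : T) : c *: (x * y)%g = ((c *: x)%R * y)%g :> T.
Proof. by have := tmulPl y c x 0; rewrite tmul0l !addr0. Qed.
Fact tscaleAr c (x y : T) : c *: (x * y)%g = (x * (c *: y)%R)%g :> T.
Proof. by have := tmulPr x c y 0; rewrite tmul0r !addr0. Qed.

HB.instance Definition _ :=
  isBilinearMonoid.Build k T tmulDl tmulDr tscaleAl tscaleAr.

Lemma tens_mulE (a a' : A) (b b' : B) :
  (tens a b * tens a' b')%g = tens (a * a')%g (b * b')%g.
Proof. exact: tmulE. Qed.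

Lemma tens_1E : 1%g = tens 1%g 1%g :> T.
Proof. by []. Qed.
End TensorAlgebra.

(* Equalities in the grading group, along which graded components are
   identified. *)
Section GradingEqualities.
Variable G : groupType.
Implicit Types a b c : G.
Local Open Scope group_scope.

Lemma conj_mul b a c : b * (a * c) * b^-1 = (b * a * b^-1) * (b * c * b^-1).
Proof. by rewrite !mulgA mulgVK. Qed.
Lemma conj_one b : b * 1 * b^-1 = 1.
Proof. by rewrite mulg1 mulgV. Qed.
Lemma conj_conj b b' a : b * (b' * a * b'^-1) * b^-1 = (b * b') * a * (b * b')^-1.
Proof. by rewrite invgM !mulgA. Qed.
Lemma conj_self a : a * a * a^-1 = a.
Proof. by rewrite mulgK. Qed.
Lemma conj_selfV a : a^-1 * a * a^-1^-1 = a.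
Proof. by rewrite mulVg mul1g invgK. Qed.
Lemma conj_invself a : a * a^-1 * a^-1 = a^-1.
Proof. by rewrite mulgV mul1g. Qed.
Lemma conjVK b a : b^-1 * (b * a * b^-1) * b^-1^-1 = a.
Proof. by rewrite !mulgA mulVg mul1g mulgK. Qed.
Lemma mul_conj a b : a * b = a * b * a^-1 * a.
Proof. by rewrite mulgVK. Qed.
End GradingEqualities.

(* Transport along an equality of degrees; by uniqueness of identity proofs in
   [G] it does not depend on the proof. *)
Definition cast (G : groupType) (k : fieldType) (C : G -> lmodType k)
    (a b : G) (e : a = b) : {linear C a -> C b} :=
  match e in _ = b' return {linear C a -> C b'} with erefl => idfun end.

Section PiCoalgebra.
Variables (G : groupType) (k : fieldType) (C : G -> lmodType k).
Variable Delta : forall a b : G, {linear C (a * b)%g -> tensor (C a) (C b)}.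
Variable eps : {linear C 1%g -> k^o}.

Record is_pi_coalgebra : Prop := IsPiCoalgebra {
  coassociative : forall (a b c : G) (x : C (a * b * c)%g),
    tassoc (tmap (Delta a b) idfun (Delta (a * b)%g c x)) =
    tmap idfun (Delta b c) (Delta a (b * c)%g (cast C (esym (mulgA a b c)) x));
  counitr : forall (a : G) (x : C a),
    tunitr (tmap idfun eps (Delta a 1%g (cast C (esym (mulg1 a)) x))) = x;
  counitl : forall (a : G) (x : C a),
    tunitl (tmap eps idfun (Delta 1%g a (cast C (esym (mul1g a)) x))) = x
}.
End PiCoalgebra.

Section AlgebraMorphism.
Variables (k : fieldType) (A B : unitalAlgType k).

Definition is_alg_hom (f : {linear A -> B}) : Prop :=
  (forall x y : A, f (x * y)%g = (f x * f y)%g) /\ f 1%g = 1%g.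

Definition is_alg_iso (f : {linear A -> B}) : Prop :=
  is_alg_hom f /\ bijective f.
End AlgebraMorphism.

Definition castA (G : groupType) (k : fieldType) (H : G -> unitalAlgType k)
    (a b : G) (e : a = b) : {linear H a -> H b} :=
  cast (fun c => H c : lmodType k) e.

Record hopf_pi_coalgebra (G : groupType) (k : fieldType) := HopfPiCoalgebra {
  hopf_car :> G -> unitalAlgType k;
  Delta : forall a b : G,
    {linear hopf_car (a * b)%g -> tensor (hopf_car a) (hopf_car b)};
  eps : {linear hopf_car 1%g -> k^o};
  antip : forall a : G, {linear hopf_car a -> hopf_car a^-1%g};
  hopf_coalgebra :
    @is_pi_coalgebra G k (fun a => hopf_car a : lmodType k) Delta eps;
  Delta_alg_hom : forall a b : G, is_alg_hom (Delta a b);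
  epsM : forall x y : hopf_car 1%g, eps (x * y)%g = eps x * eps y;
  eps1 : eps 1%g = 1;
  antipl : forall (a : G) (x : hopf_car 1%g),
    amul_map (hopf_car a) (tmap
      (castA hopf_car (invgK a) \o antip a^-1%g) idfun
      (Delta a^-1%g a (castA hopf_car (esym (mulVg a)) x)))
    = (eps x : k) *: (1%g : hopf_car a);
  antipr : forall (a : G) (x : hopf_car 1%g),
    amul_map (hopf_car a) (tmap
      idfun (castA hopf_car (invgK a) \o antip a^-1%g)
      (Delta a a^-1%g (castA hopf_car (esym (mulgV a)) x)))
    = (eps x : k) *: (1%g : hopf_car a)
}.

Arguments Delta {G k} H a b : rename.
Arguments eps {G k} H : rename.
Arguments antip {G k} H a : rename.

(* The antipode on the component of degree a^-1, with values in degree a. *)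
Definition antipV (G : groupType) (k : fieldType)
    (H : hopf_pi_coalgebra G k) (a : G) : {linear H a^-1%g -> H a} :=
  castA H (invgK a) \o antip H a^-1%g.

Record crossed_hopf_pi_coalgebra (G : groupType) (k : fieldType) :=
    CrossedHopfPiCoalgebra {
  crossed_hopf :> hopf_pi_coalgebra G k;
  crossing : forall b a : G,
    {linear crossed_hopf a -> crossed_hopf (b * a * b^-1)%g};
  crossing_alg_iso : forall b a : G, is_alg_iso (crossing b a);
  crossing_Delta : forall (b a c : G) (x : crossed_hopf (a * c)%g),
    tmap (crossing b a) (crossing b c) (Delta crossed_hopf a c x) =
    Delta crossed_hopf (b * a * b^-1)%g (b * c * b^-1)%g
      (castA crossed_hopf (conj_mul b a c) (crossing b (a * c)%g x));
  crossing_eps : forall (b : G) (x : crossed_hopf 1%g),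
    eps crossed_hopf (castA crossed_hopf (conj_one b) (crossing b 1%g x)) =
    eps crossed_hopf x;
  crossingM : forall (b b' a : G) (x : crossed_hopf a),
    crossing (b * b')%g a x =
    castA crossed_hopf (conj_conj b b' a)
      (crossing b (b' * a * b'^-1)%g (crossing b' a x))
}.

Arguments crossing {G k} H b a : rename.

(* The crossing by b on degree a, with its target degree b * a * b^-1 rewritten
   as c. *)
Definition crossing_to (G : groupType) (k : fieldType)
    (H : crossed_hopf_pi_coalgebra G k) (b a c : G)
    (e : (b * a * b^-1)%g = c) : {linear H a -> H c} :=
  castA H e \o crossing H b a.

(* Legs of tensors inside A (x) (B (x) C), the common target chosen for triple
   tensor products. *)
Section Legs.
Variable k : fieldType.

Definition leg12 (A B C : unitalAlgType k) (r : tensor A B) :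
    tensor A (tensor B C) :=
  tassoc (tens r (1%g : C)).

Definition leg23 (A B C : unitalAlgType k) (r : tensor B C) :
    tensor A (tensor B C) :=
  tens (1%g : A) r.

Definition leg13 (A B C : unitalAlgType k) (r : tensor A C) :
    tensor A (tensor B C) :=
  tmap idfun (tensl (V := C) (1%g : B)) r.
End Legs.

Arguments leg12 {k A B} C r.
Arguments leg23 {k} A {B C} r.
Arguments leg13 {k A} B {C} r.

Record quasitriangular_hopf_pi_coalgebra (G : groupType) (k : fieldType) :=
    QuasitriangularHopfPiCoalgebra {
  qt_crossed :> crossed_hopf_pi_coalgebra G k;
  Rmx : forall a b : G, tensor (qt_crossed a) (qt_crossed b);
  Rmx_invertible : forall a b : G, invertible (Rmx a b);
  Rmx_Delta : forall (a b : G) (x : qt_crossed (a * b)%g),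
    (Rmx a b * Delta qt_crossed a b x)%g =
    (tflip (tmap (crossing_to qt_crossed (conjVK a b)) idfun
       (Delta qt_crossed (a * b * a^-1)%g a
          (castA qt_crossed (mul_conj a b) x))) * Rmx a b)%g;
  Rmx_Deltar : forall a b c : G,
    tmap idfun (Delta qt_crossed b c) (Rmx a (b * c)%g) =
    (leg13 (qt_crossed b) (Rmx a c) * leg12 (qt_crossed c) (Rmx a b))%g;
  Rmx_Deltal : forall a b c : G,
    tassoc (tmap (Delta qt_crossed a b) idfun (Rmx (a * b)%g c)) =
    (leg13 (qt_crossed b)
       (tmap idfun (crossing_to qt_crossed (conjVK b c))
          (Rmx a (b * c * b^-1)%g))
     * leg23 (qt_crossed a) (Rmx b c))%g;
  Rmx_crossing : forall a b c : G,
    tmap (crossing qt_crossed b a) (crossing qt_crossed b c) (Rmx a c) =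
    Rmx (b * a * b^-1)%g (b * c * b^-1)%g
}.

Arguments Rmx {G k} H a b : rename.

Definition drinfeld (G : groupType) (k : fieldType)
    (H : quasitriangular_hopf_pi_coalgebra G k) (a : G) : H a :=
  amul_map (H a)
    (tmap (antipV H a \o crossing_to H (conj_invself a)) idfun
      (tflip (Rmx H a a^-1%g))).

(* Main.v *)
(* In Sweedler notation write R = sum p (x) q. The hexagon identities (ii)
   combined with the antipode axioms give R^{-1} = sum S(phi p) (x) q, the two
   cancellations sum p p' (x) S(q') q = 1 = sum p p' (x) q' S(q), and the
   invariance of R under S^2 (x) S^2. Feeding the quasi-cocommutativity (i),
   applied to the first two legs of x_1 (x) x_2 (x) x_3,
     into the definition of u
   yields u x = S^2(phi x) u; with v = sum q S^2(p) the formula for R^{-1} turns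
   this into u v = 1, and v = S^2(phi v) then gives v u = u v = 1.
   For the coproduct, P = phi(R_21) R satisfies
   P Delta(phi x) = (phi (x) phi)(Delta x) P, so P Delta(u) becomes a sum with P
   placed between Delta(S q) and Delta(p); expanding both by (ii),
     exchanging with
   the Yang-Baxter equation and cancelling twice leaves u (x) u. *)
Require Import Defs.
From HB Require Import structures.
From mathcomp Require Import all_boot all_order all_algebra.
From mathcomp Require Import boolp.

Set Implicit Arguments.
Unset Strict Implicit.
Unset Printing Implicit Defensive.

Import GRing.Theory.
Local Open Scope ring_scope.

(** * Sweedler sums *)

(** Linearity is a predicate on bare functions, so that an integrand written as a lambda term needs
    no bundled structure; the tactic [lin] proves it by following the syntax. *)
Definition lin (k : fieldType) (U V : lmodType k) (f : U -> V) : Prop :=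
  forall (c : k) x y, f (c *: x + y) = c *: f x + f y.

Definition bil (k : fieldType) (U V W : lmodType k) (f : U -> V -> W) : Prop :=
  (forall v, lin (f^~ v)) /\ (forall u, lin (f u)).

Definition tri (k : fieldType) (U V W X : lmodType k) (f : U -> V -> W -> X) :
    Prop :=
  [/\ forall v w, lin (fun u => f u v w), forall u w, lin (fun v => f u v w) &
    forall u v, lin (fun w => f u v w)].

Section LinTheory.
Variable k : fieldType.
Implicit Types U V W X Y : lmodType k.

Lemma lin0 U V (f : U -> V) : lin f -> f 0 = 0.
Proof. by move=> fL; have := fL (-1) 0 0;
  rewrite scaler0 addr0 scaleN1r addNr. Qed.

Lemma linD U V (f : U -> V) x y : lin f -> f (x + y) = f x + f y.
Proof. by move=> fL; have := fL 1 x y; rewrite !scale1r. Qed.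

Lemma linZ U V (f : U -> V) c x : lin f -> f (c *: x) = c *: f x.
Proof. by move=> fL; have := fL c x 0; rewrite (lin0 fL) !addr0. Qed.

Lemma lin_id U : lin (fun x : U => x).
Proof. by []. Qed.

Lemma lin_app U V W (f : {linear V -> W}) (g : U -> V) :
  lin g -> lin (fun x => f (g x)).
Proof. by move=> gL c x y; rewrite gL linearP. Qed.

Lemma lin_mull U (A : unitalAlgType k) (f : U -> A) (y : A) :
  lin f -> lin (fun x => (f x * y)%g).
Proof. by move=> fL c x x'; rewrite fL amulDl ascalerAl. Qed.

Lemma lin_mulr U (A : unitalAlgType k) (f : U -> A) (y : A) :
  lin f -> lin (fun x => (y * f x)%g).
Proof. by move=> fL c x x'; rewrite fL amulDr ascalerAr. Qed.

Lemma lin_tensl U V W (f : U -> V) (w : W) : lin f ->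
  lin (fun x => tens (f x) w).
Proof. by move=> fL c x y; rewrite fL tensPl. Qed.

Lemma lin_tensr U V W (f : U -> V) (w : W) : lin f ->
  lin (fun x => tens w (f x)).
Proof. by move=> fL c x y; rewrite fL tensPr. Qed.

Lemma lin_bill U V W X (f : U -> V -> W) (g : X -> U) v :
  bil f -> lin g -> lin (fun x => f (g x) v).
Proof. by case=> fl _ gL c x y; rewrite gL fl. Qed.

Lemma lin_bilr U V W X (f : U -> V -> W) (g : X -> V) u :
  bil f -> lin g -> lin (fun x => f u (g x)).
Proof. by case=> _ fr gL c x y; rewrite gL fr. Qed.

Lemma lin_tri1 U V W X Y (f : U -> V -> W -> X) (g : Y -> U) (v : V) (w : W) :
  tri f -> lin g -> lin (fun x => f (g x) v w).
Proof. by case=> f1 _ _ gL c x y; rewrite gL f1. Qed.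

Lemma lin_tri2 U V W X Y (f : U -> V -> W -> X) (g : Y -> V) (u : U) (w : W) :
  tri f -> lin g -> lin (fun x => f u (g x) w).
Proof. by case=> _ f2 _ gL c x y; rewrite gL f2. Qed.

Lemma lin_tri3 U V W X Y (f : U -> V -> W -> X) (g : Y -> W) (u : U) (v : V) :
  tri f -> lin g -> lin (fun x => f u v (g x)).
Proof. by case=> _ _ f3 gL c x y; rewrite gL f3. Qed.

Lemma lin_scale U V (f : U -> V) (d : k) : lin f -> lin (fun x => d *: f x).
Proof. by move=> fL c x y; rewrite fL scalerDr !scalerA mulrC. Qed.

Lemma lin_scalel U V (f : U -> k^o) (v : V) : lin f ->
  lin (fun x => (f x : k) *: v).
Proof. by move=> fL c x y; rewrite fL scalerDl scalerA. Qed.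

Lemma tensor_sum U V (t : tensor U V) :
  exists s : seq (U * V), t = \sum_(p <- s) tens p.1 p.2.
Proof.
elim/tensor_ind: t => [|u v]; last by exists [:: (u, v)]; rewrite big_seq1.
split=> [|c x y [s ->] [r ->]]; first by exists [::]; rewrite big_nil.
exists ([seq (c *: p.1, p.2) | p <- s] ++ r).
rewrite big_cat big_map scaler_sumr; congr (_ + _); apply: eq_bigr => p _ /=.
exact/esym/(linZ (f := tens^~ p.2))/tensPl.
Qed.

Definition tseq U V (t : tensor U V) : seq (U * V) :=
  projT1 (cid (tensor_sum t)).

Lemma tseqE U V (t : tensor U V) : t = \sum_(p <- tseq t) tens p.1 p.2.
Proof. by rewrite /tseq; case: cid. Qed.

(* Sweedler sum: the value on [t = sum_i u_i (x) v_i] of the map induced by [f].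
   It is meaningful only for bilinear [f], as it uses a chosen decomposition. *)
Definition sw U V W (t : tensor U V) (f : U -> V -> W) : W :=
  \sum_(p <- tseq t) f p.1 p.2.

Lemma sw_tens U V (t : tensor U V) : sw t (fun u v => tens u v) = t.
Proof. by rewrite [RHS]tseqE. Qed.

Lemma sw_eq U V W (t : tensor U V) (f g : U -> V -> W) :
  (forall u v, f u v = g u v) -> sw t f = sw t g.
Proof. by move=> fg; apply: eq_bigr. Qed.

Lemma lin_sum I U V (s : seq I) (g : U -> V) (F : I -> U) :
  lin g -> g (\sum_(i <- s) F i) = \sum_(i <- s) g (F i).
Proof.
by move=> gL; elim: s => [|i s IH]; rewrite ?big_nil ?lin0 // !big_cons linD
  ?IH.
Qed.

Lemma sw_lin U V W X (t : tensor U V) (f : U -> V -> W) (g : W -> X) :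
  lin g -> g (sw t f) = sw t (fun u v => g (f u v)).
Proof. exact: lin_sum. Qed.

Lemma sw_exchange U V U' V' W (t : tensor U V) (t' : tensor U' V')
    (f : U -> V -> U' -> V' -> W) :
  sw t (fun u v => sw t' (fun u' v' => f u v u' v')) =
  sw t' (fun u' v' => sw t (fun u v => f u v u' v')).
Proof. exact: exchange_big. Qed.

(** For bilinear [f] the chosen decomposition does not matter: the sum is the value of the linear
    map that the universal property attaches to [f]. *)
Lemma swP U V W (f : U -> V -> W) : bil f ->
  exists2 F : {linear tensor U V -> W},
    forall u v, F (tens u v) = f u v & forall t, sw t f = F t.
Proof.
move=> [fl fr].
pose m := bilinear_isBilinear.Build k U V W *:%R *:%R f (bilinearI fl fr).
pose B : {bilinear U -> V -> W} := HB.pack f m.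
have BE u v : tlift B (tens u v) = f u v by exact: tliftE.
exists (tlift B) => // t.
rewrite [in RHS](tseqE t) lin_sum; last exact: linearP.
by apply: eq_bigr => p _; exact: esym (BE _ _).
Qed.

Lemma swE U V W (f : U -> V -> W) u v : bil f -> sw (tens u v) f = f u v.
Proof. by case/swP=> F Ff ->. Qed.

Lemma lin_swt U V W X (t : X -> tensor U V) (f : U -> V -> W) :
  lin t -> bil f -> lin (fun x => sw (t x) f).
Proof. by move=> tL /swP[F _ FE] c x y; rewrite !FE tL linearP. Qed.

Lemma lin_sw U V W X (t : tensor U V) (f : X -> U -> V -> W) :
  (forall u v, lin (fun x => f x u v)) -> lin (fun x => sw t (f x)).
Proof.
move=> fL c x y; rewrite /sw scaler_sumr -big_split.
by apply: eq_bigr => p _; exact: fL.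
Qed.

(** Reduces identities that are linear in [t] to pure tensors. *)
Lemma swg U V W (t : tensor U V) (f : tensor U V -> W) :
  lin f -> f t = sw t (fun u v => f (tens u v)).
Proof. by move=> fL; rewrite -sw_lin // sw_tens. Qed.

End LinTheory.

(** Recursion on the shape of the function. A Sweedler sum is entered through its integrand
    ([lin_sw]) or through its tensor ([lin_swt]), according to where the variable occurs. *)
Ltac lin :=
  lazymatch goal with
  | H : bil ?F |- bil ?F => exact: H
  | H : tri ?F |- tri ?F => exact: H
  | H : bil ?F |- lin (?F _) => exact: (proj2 H)
  | |- bil _ => split=> ? /=; lin
  | |- tri _ => split=> ? ? /=; lin
  | H : bil ?F |- lin (fun x => ?F _ _) =>
      first [apply: (lin_bill _ H); lin | apply: (lin_bilr _ H); lin]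
  | H : tri ?F |- lin (fun x => ?F _ _ _) =>
      first [apply: (lin_tri1 _ _ H); lin | apply: (lin_tri2 _ _ H); lin
            | apply: (lin_tri3 _ _ H); lin]
  | |- lin _ => first
    [ exact: lin_id
    | apply: lin_tensl; lin
    | apply: lin_tensr; lin
    | apply: lin_mull; lin
    | apply: lin_mulr; lin
    | apply: lin_sw => ? ? /=; lin
    | apply: lin_swt; lin
    | apply: lin_scalel; lin
    | apply: lin_scale; lin
    | apply: lin_app; lin
    | assumption ]
  end.

Section SweedlerMaps.
Variable k : fieldType.
Implicit Types U V W X Y : lmodType k.

Lemma sw_tmap U V U' V' W (f : {linear U -> U'}) (g : {linear V -> V'})
    (t : tensor U V) (F : U' -> V' -> W) : bil F ->
  sw (tmap f g t) F = sw t (fun u v => F (f u) (g v)).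
Proof.
move=> FB; rewrite (swg t (f := fun t => sw (tmap f g t) F)); last by lin.
by apply: sw_eq => u v; rewrite tmapE swE.
Qed.

Lemma sw_tflip U V W (t : tensor U V) (F : V -> U -> W) : bil F ->
  sw (tflip t) F = sw t (fun u v => F v u).
Proof.
move=> FB; rewrite (swg t (f := fun t => sw (tflip t) F)); last by lin.
by apply: sw_eq => u v; rewrite tflipE swE.
Qed.

Lemma sw_mul (A B : unitalAlgType k) W (s t : tensor A B) (F : A -> B -> W) :
  bil F ->
  sw (s * t)%g F =
  sw s (fun a b => sw t (fun a' b' => F (a * a')%g (b * b')%g)).
Proof.
move=> FB; rewrite (swg s (f := fun s => sw (s * t)%g F)); last by lin.
apply: sw_eq => a b.
rewrite (swg t (f := fun t => sw (tens a b * t)%g F)); last by lin.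
by apply: sw_eq => a' b'; rewrite tens_mulE swE.
Qed.

End SweedlerMaps.

(** * Structure maps without transports *)

(** Side conditions on degrees are equalities of words in the group: degree variables are
    eliminated, then both words are normalised. *)
Ltac solve_degree := by move=> *; subst;
  rewrite ?(invgM, invgK, mulgA, mulgK, mulgVK, mulgV, mulVg, mul1g, mulg1,
    invg1).

Section TotalTransport.
Variables (G : groupType) (k : fieldType) (H : hopf_pi_coalgebra G k).

(* Transport between degrees made total (zero between distinct degrees), so that
   it takes no proof argument. *)
Definition transport (a b : G) : {linear H a -> H b} :=
  match a =P b with
  | ReflectT e => castA H e
  | ReflectF _ => (\0 : {linear H a -> H b})%R
  end.

Lemma castA_transport a b (e : a = b) x : castA H e x = transport a b x.
Proof. by rewrite /transport; case: eqP => // e';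
  rewrite (eq_irrelevance e e'). Qed.

Lemma transport_id a x : transport a a x = x.
Proof. by rewrite -(castA_transport erefl). Qed.

Lemma transport_comp a b c x : a = b -> transport b c (transport a b x) =
  transport a c x.
Proof. by move=> e; subst; rewrite transport_id. Qed.

(** The source degree is a parameter of its own, tied to [a * b] only by hypotheses of the lemmas:
    rebracketing degrees costs an equation in the group, not a cast in the term. [antipode] and
    [cross] free their target degree in the same way. *)
Definition comul (ab a b : G) : {linear H ab -> tensor (H a) (H b)} :=
  Delta H a b \o transport ab (a * b)%g.

Definition antipode (a a' : G) : {linear H a -> H a'} :=
  transport a^-1%g a' \o antip H a.

End TotalTransport.

Arguments comul {G k H ab} a b.
Arguments antipode {G k H a} a'.

Section Hopf.
Variables (G : groupType) (k : fieldType) (H : hopf_pi_coalgebra G k).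
Implicit Types a b c : G.
Local Open Scope group_scope.
Local Notation D := (@comul G k H _).
Local Notation S := (@antipode G k H _).
Local Notation eps := (eps H).

Lemma antipode_antip a (x : H a) : S a^-1 x = antip H a x.
Proof. exact: transport_id. Qed.

Lemma antipode_antipV a (x : H a^-1) : S a x = antipV H a x.
Proof. by rewrite /antipV /= castA_transport. Qed.

Lemma comulE a b (x : H (a * b)) : D a b x = Delta H a b x.
Proof. by rewrite /comul /= transport_id. Qed.

Lemma comulA ab bc abc a b c (x : H abc) (W : lmodType k)
    (F : H a -> H b -> H c -> W) :
  tri F -> ab = a * b -> bc = b * c -> abc = a * b * c ->
  sw (D ab c x) (fun y w => sw (D a b y) (fun u v => F u v w)) =
  sw (D a bc x) (fun u y => sw (D b c y) (fun v w => F u v w)).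
Proof.
move=> FT e1 e2 e3; subst.
(* [Q] evaluates [F] on a threefold tensor; applied to both sides of the axiom, it yields an
   identity of Sweedler sums. *)
pose Q (t : tensor (H a) (tensor (H b) (H c))) :=
  sw t (fun u y => sw y (fun v w => F u v w)).
have QL : lin Q by rewrite /Q; lin.
have QE u y : Q (tens u y) = sw y (fun v w => F u v w) by rewrite /Q swE //;
  lin.
have := congr1 Q (coassociative (hopf_coalgebra H) x).
rewrite -[cast _ _ x]/(castA H _ x) castA_transport -[Delta H a _ _]/(D a (b *
  c) x).
rewrite -[Delta H _ c x]comulE.
rewrite (swg (D a _ x) (f := fun t => Q (tmap idfun (Delta H b c) t)));
  last first.
  by move=> d t t'; rewrite !linearP QL.
rewrite (swg (D _ c x) (f := fun t => Q (tassoc (tmap (Delta H a b) idfun t)))).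
  move=> E; transitivity (sw (D (a * b) c x)
    (fun y w => Q (tassoc (tmap (Delta H a b) idfun (tens y w))))).
    apply: sw_eq => y w; rewrite tmapE comulE.
    rewrite (swg (Delta H a b y) (f := fun t => Q (tassoc (tens t w)))).
      by apply: sw_eq => u v; rewrite tassocE QE swE //; lin.
    by move=> d t t'; rewrite tensPl !linearP QL.
  by rewrite E; apply: sw_eq => u y; rewrite tmapE QE comulE.
by move=> d t t'; rewrite !linearP QL.
Qed.

Lemma comul_epsr a (x : H a) (W : lmodType k) (f : H a -> W) : lin f ->
  sw (D a 1 x) (fun u v => (eps v : k) *: f u) = f x.
Proof.
move=> fL; rewrite -[in RHS](counitr (hopf_coalgebra H) x).
rewrite -[cast _ _ x]/(castA H _ x) castA_transport.
rewrite [in RHS](swg (Delta H a 1 _) (f :=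
  fun t => f (tunitr (tmap idfun eps t)))).
  by apply: sw_eq => u v; rewrite tmapE tunitrE linZ.
by move=> c y z; rewrite !linearP /= fL.
Qed.

Lemma comul_epsl a (x : H a) (W : lmodType k) (f : H a -> W) : lin f ->
  sw (D 1 a x) (fun u v => (eps u : k) *: f v) = f x.
Proof.
move=> fL; rewrite -[in RHS](counitl (hopf_coalgebra H) x).
rewrite -[cast _ _ x]/(castA H _ x) castA_transport.
rewrite [in RHS](swg (Delta H 1 a _) (f :=
  fun t => f (tunitl (tmap eps idfun t)))).
  by apply: sw_eq => u v; rewrite tmapE tunitlE linZ.
by move=> c y z; rewrite !linearP /= fL.
Qed.

Lemma comul_antipl a a' (x : H 1) : a' = a^-1 ->
  sw (D a' a x) (fun u v => S a u * v) = (eps x : k) *: (1%g : H a).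
Proof.
move=> ->; rewrite -antipl castA_transport.
rewrite [in RHS](swg (Delta H a^-1 a _) (f := fun t =>
  amul_map _ (tmap (castA H (invgK a) \o antip H a^-1) idfun t))); last by lin.
by apply: sw_eq => u v; rewrite tmapE amul_mapE /= castA_transport.
Qed.

Lemma comul_antipr a a' (x : H 1) : a' = a^-1 ->
  sw (D a a' x) (fun u v => u * S a v) = (eps x : k) *: (1%g : H a).
Proof.
move=> ->; rewrite -antipr castA_transport.
rewrite [in RHS](swg (Delta H a a^-1 _) (f := fun t =>
  amul_map _ (tmap idfun (castA H (invgK a) \o antip H a^-1) t))); last by lin.
by apply: sw_eq => u v; rewrite tmapE amul_mapE /= castA_transport.
Qed.

Lemma comulM ab a b (x y : H ab) : ab = a * b -> D a b (x * y) =
  D a b x * D a b y.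
Proof. by move=> e; subst; rewrite !comulE; case: (Delta_alg_hom H a b). Qed.

Lemma comul1 ab a b : ab = a * b -> D a b (1 : H ab) = 1.
Proof. by move=> e; subst; rewrite !comulE; case: (Delta_alg_hom H a b). Qed.

End Hopf.

(** * The antipode *)

Section Antipode.
Variables (G : groupType) (k : fieldType) (H : hopf_pi_coalgebra G k).
Implicit Types a b c : G.
Local Open Scope group_scope.
Local Notation D := (@comul G k H _).
Local Notation S := (@antipode G k H _).
Local Notation eps := (eps H).

Lemma eq_inv a b : a = b^-1 -> b = a^-1. Proof. by move=> ->; rewrite invgK.
  Qed.

Lemma antipode1 a a' : a' = a^-1 -> S a' (1 : H a) = 1.
Proof.
move=> /eq_inv e; subst; rewrite -[RHS]scale1r -[X in X *: _](eps1 H)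
  -(@comul_antipl _ _ H a' a'^-1) //.
by rewrite comul1 ?swE ?mulg1; [by []|lin|solve_degree].
Qed.

Lemma sw_mull (U V : lmodType k) (A : unitalAlgType k) (t : tensor U V)
  (f : U -> V -> A) y :
  sw t f * y = sw t (fun u v => f u v * y).
Proof. by rewrite (sw_lin _ _ (g := fun x => x * y)) //; lin. Qed.

Lemma sw_mulr (U V : lmodType k) (A : unitalAlgType k) (t : tensor U V)
  (f : U -> V -> A) y :
  y * sw t f = sw t (fun u v => y * f u v).
Proof. by rewrite (sw_lin _ _ (g := fun x => y * x)) //; lin. Qed.

(** Both sides are contractions of the sum of S(y1) S(x1) x2 y2 S(x3 y3): contracting x2 y2 S(x3 y3)
    leaves S(y) S(x), while contracting S(x1) x2 and then S(y1) y2 leaves S(x y). *)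
Lemma antipodeM a a' (x y : H a) : a' = a^-1 -> S a' (x * y) = S a' y * S a' x.
Proof.
move=> /eq_inv e; subst; rename a' into a.
pose T1 := sw (D a^-1 1 x) (fun x1 z => sw (D a^-1 1 y) (fun y1 w =>
  sw (D a a^-1 z) (fun x2 x3 => sw (D a a^-1 w) (fun y2 y3 =>
  S a y1 * (S a x1 * x2 * y2) * S a (x3 * y3))))).
have -> : S a y * S a x = T1.
  rewrite -(comul_epsr x (f := fun x => S a y * S a x)); last by lin.
  apply: sw_eq => x1 z.
  rewrite -(comul_epsr y (f := fun y => (eps z : k) *: (S a y * S a x1)%g));
    last by lin.
  apply: sw_eq => y1 w.
  transitivity (S a y1 * S a x1 *
     sw (D a a^-1 z * D a a^-1 w) (fun u v => u * S a v)).
    by rewrite -comulM ?comul_antipr ?epsM -?ascalerAr ?mulg1 ?scalerA 1?mulrC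
      //; solve_degree.
  rewrite sw_mul; last by lin.
  rewrite sw_mulr; apply: sw_eq => x2 x3; rewrite sw_mulr;
    apply: sw_eq => y2 y3.
  by rewrite !mulgA.
(* Coassociativity, once for [x] and once for [y], moves the brackets to the first two factors. *)
have -> : T1 = sw (D 1 a^-1 x) (fun z x3 => sw (D 1 a^-1 y) (fun w y3 =>
  sw (D a^-1 a z) (fun x1 x2 => sw (D a^-1 a w) (fun y1 y2 =>
  S a y1 * (S a x1 * x2 * y2) * S a (x3 * y3))))).
  rewrite /T1.
  under sw_eq => x1 z do rewrite sw_exchange.
  rewrite -(@comulA _ _ _ 1 1 _ a^-1 a a^-1);
    [|lin|solve_degree|solve_degree|solve_degree].
  under [RHS]sw_eq => z x3 do rewrite sw_exchange.
  apply: sw_eq => z x3; apply: sw_eq => x1 x2.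
  by rewrite -(@comulA _ _ _ 1 1 _ a^-1 a a^-1);
    [|lin|solve_degree|solve_degree|solve_degree].
rewrite -[in LHS](comul_epsl x (f := fun x => S a (x * y))); last by lin.
apply: sw_eq => z x3.
rewrite -[in LHS](comul_epsl y (f := fun y => (eps z : k) *: S a (x3 * y)%g));
  last by lin.
apply: sw_eq => w y3.
transitivity ((eps z : k) *: (sw (D a^-1 a w)
  (fun y1 y2 => S a y1 * y2) * S a (x3 * y3))%g).
  by rewrite comul_antipl // -ascalerAl mul1g !scalerA mulrC.
transitivity (sw (D a^-1 a z) (fun x1 x2 => sw (D a^-1 a w)
  (fun y1 y2 => S a y1 * ((S a x1 * x2) * (y2 * S a (x3 * y3)))))); last first.
  by apply: sw_eq => ? ?; apply: sw_eq => ? ?; rewrite !mulgA.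
rewrite sw_exchange sw_mull (sw_lin _ _ (g := fun x => (eps z : k) *: x));
  last by lin.
apply: sw_eq => y1 y2.
by rewrite -sw_mulr -sw_mull comul_antipl // -ascalerAl -ascalerAr mul1g mulgA.
Qed.

(** A left and a right convolution inverse of [I] coincide, by evaluating the convolution of [F],
    [I] and [F'] in two ways. *)
Lemma conv_uniq a a' (A : unitalAlgType k) (F F' : H a -> A) (I : H a' -> A) :
  a' = a^-1 -> lin F -> lin I -> lin F' ->
  (forall z, sw (D a a' z) (fun u v => F u * I v) = (eps z : k) *: (1%g : A)) ->
  (forall z, sw (D a' a z) (fun u v => I u * F' v) =
    (eps z : k) *: (1%g : A)) ->
  F =1 F'.
Proof.
move=> e FL IL FL' FI IF' x; subst.
rewrite -[LHS](comul_epsr x FL) -[RHS](comul_epsl x FL').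
transitivity (sw (D a 1 x) (fun u z => sw (D a^-1 a z)
  (fun v w => F u * I v * F' w))).
  apply: sw_eq => u z; rewrite -[in LHS](mulg1 (F u)) ascalerAr -IF' sw_mulr.
  by apply: sw_eq => v w; rewrite mulgA.
rewrite -(@comulA _ _ _ 1 1 _ a a^-1 a);
  [|lin|solve_degree|solve_degree|solve_degree].
by apply: sw_eq => z w; rewrite -sw_mull FI -ascalerAl mul1g.
Qed.

Lemma eps_antipode (x : H 1) : eps (S 1 x) = eps x.
Proof.
transitivity (eps (sw (D 1 1 x) (fun u v => S 1 u * v))); last first.
  by rewrite comul_antipl ?invg1 // linearZ /= eps1 [LHS]mulr1.
rewrite (sw_lin _ _ (g := eps)); last by lin.
rewrite -[in LHS](comul_epsr x (f := fun x => eps (S 1 x))); last by lin.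
by apply: sw_eq => u v; rewrite epsM mulrC.
Qed.

(** Both sides are convolution inverses of the comultiplication, with values in the tensor product
    algebra. It suffices to treat the universal case where [F] is [tens]. *)
Lemma comul_antipode c a b c' a' b' (x : H c) (W : lmodType k) (F : H b' ->
  H a' -> W) :
  bil F -> c = a * b -> c' = c^-1 -> a' = a^-1 -> b' = b^-1 ->
  sw (D b' a' (S c' x)) F = sw (D a b x) (fun u v => F (S b' v) (S a' u)).
Proof.
move=> FB ec ec' ea eb.
have e : c' = b' * a' by solve_degree.
pose F' (x : H c) := sw (D a b x) (fun u v => tens (S b' v) (S a' u)).
suff E : D b' a' (S c' x) = F' x.
  rewrite E /F' (sw_lin _ _ (g := fun t => sw t F)); last by lin.
  by apply: sw_eq => u v; rewrite swE.
apply: (@conv_uniq c c' (tensor (H b') (H a')) (fun x => D b' a' (S c' x))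
  F' (fun y => D b' a' y)); rewrite /F' //; first [lin | move=> z].
  under sw_eq => u v do rewrite -comulM //.
  rewrite -(sw_lin _ _ (g := fun y => D b' a' y)); last by lin.
  by rewrite comul_antipl ?linearZ ?comul1 //; solve_degree.
(* Coassociativity brings the inner factors u2 and v1 together; they contract first, after which u1
   and v2 become adjacent. *)
transitivity (sw (D b' b z) (fun u1 y => sw (D 1 b y) (fun p v2 => sw (D a' a p)
  (fun u2 v1 => tens (u1 * S b' v2)%g (u2 * S a' v1)%g)))).
  transitivity (sw (D c' c z) (fun u v => sw (D b' a' u) (fun u1 u2 =>
    sw (D a b v) (fun v1 v2 => tens (u1 * S b' v2)%g (u2 * S a' v1)%g)))).
    apply: sw_eq => u v; rewrite -[in LHS](sw_tens (D b' a' u)) sw_mull.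
    by apply: sw_eq => u1 u2; rewrite sw_mulr; apply: sw_eq => v1 v2;
      rewrite tens_mulE.
  rewrite (@comulA _ _ _ c' b _ b' a' c);
    [|lin|solve_degree|solve_degree|solve_degree].
  apply: sw_eq => u1 y.
  by rewrite -(@comulA _ _ _ 1 c _ a' a b);
    [|lin|solve_degree|solve_degree|solve_degree].
transitivity (sw (D b' b z) (fun u1 y => tens (u1 * S b' y)%g (1%g : H a'))).
  apply: sw_eq => u1 y.
  rewrite -[in RHS](comul_epsl y (f := fun y => tens (u1 * S b' y)%g (1%g : H
    a'))); last by lin.
  apply: sw_eq => p v2.
  rewrite -(sw_lin _ _ (g := fun q => tens (u1 * S b' v2)%g q)); last by lin.
  by rewrite comul_antipr ?(linZ (f := fun q => tens _ q)) //;
    [lin|solve_degree].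
rewrite -(sw_lin _ _ (g := fun q => tens q (1%g : H a'))); last by lin.
by rewrite comul_antipr ?(linZ (f := fun q => tens q _)) //; [lin|solve_degree].
Qed.

End Antipode.

(** * The crossing *)

Definition cross (G : groupType) (k : fieldType)
    (H : crossed_hopf_pi_coalgebra G k) (a b a' : G) : {linear H a -> H a'} :=
  transport H (b * a * b^-1)%g a' \o crossing H b a.

Arguments cross {G k H a} b a'.

Section Crossing.
Variables (G : groupType) (k : fieldType) (H : crossed_hopf_pi_coalgebra G k).
Implicit Types a b c : G.
Local Open Scope group_scope.
Local Notation D := (@comul G k H _).
Local Notation S := (@antipode G k H _).
Local Notation eps := (eps H).
Local Notation Phi := (@cross G k H _).

Lemma cross_to b a c (e : b * a * b^-1 = c) x : crossing_to H e x = Phi b c x.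
Proof. exact: castA_transport. Qed.

Lemma cross_crossing b a x : crossing H b a x = Phi b (b * a * b^-1) x.
Proof. by rewrite /cross /= transport_id. Qed.

Lemma crossM b a a' (x y : H a) : a' = b * a * b^-1 ->
  Phi b a' (x * y) = Phi b a' x * Phi b a' y.
Proof.
by move=> ->; rewrite -!cross_crossing; case: (crossing_alg_iso H b a) => -[].
Qed.

Lemma cross1 b a a' : a' = b * a * b^-1 -> Phi b a' (1 : H a) = 1.
Proof.
by move=> ->; rewrite -!cross_crossing; case: (crossing_alg_iso H b a) => -[].
Qed.

Lemma cross_comp b b' a a' a'' (x : H a) : a' = b' * a * b'^-1 ->
  Phi b a'' (Phi b' a' x) = Phi (b * b') a'' x.
Proof.
move=> ->; rewrite -cross_crossing /cross /= crossingM castA_transport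
  transport_comp //.
exact: conj_conj.
Qed.

(** The crossing by 1 is idempotent and injective, hence the identity. *)
Lemma cross_id b a (x : H a) : b = 1 -> Phi b a x = x.
Proof.
move=> ->; have [[_ [g gK _]] e] := (crossing_alg_iso H 1 a, conj_one a).
have {}e : a = 1 * a * 1^-1 by solve_degree.
have inj (y z : H a) : Phi 1 a y = Phi 1 a z -> y = z.
  move=> E; rewrite -[y]gK -[z]gK !cross_crossing.
  have trE (w : H a) : Phi 1 (1 * a * 1^-1) w = transport H a _ (Phi 1 a w).
    by rewrite /cross /= transport_comp //; exact: esym e.
  by rewrite !trE E.
by apply: inj; rewrite cross_comp // mulg1.
Qed.

Lemma crossK b b' a a' (x : H a) : b * b' = 1 -> a' = b' * a * b'^-1 ->
  Phi b a (Phi b' a' x) = x.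
Proof. by move=> e1 e2; rewrite cross_comp // cross_id. Qed.

Lemma eps_cross b (x : H 1) : eps (Phi b 1 x) = eps x.
Proof. by rewrite -(crossing_eps b x) castA_transport. Qed.

Lemma comul_cross b ac a c ac' a' c' (x : H ac) (W : lmodType k)
    (F : H a' -> H c' -> W) :
  bil F -> ac = a * c -> ac' = b * ac * b^-1 -> a' = b * a * b^-1 ->
  c' = b * c * b^-1 ->
  sw (D a' c' (Phi b ac' x)) F =
  sw (D a c x) (fun u v => F (Phi b a' u) (Phi b c' v)).
Proof.
move=> FB *; subst.
under [RHS]sw_eq => u v do rewrite -!cross_crossing.
rewrite -sw_tmap // comulE crossing_Delta castA_transport -comulE.
by rewrite cross_crossing /cross /= !transport_comp //; solve_degree.
Qed.

(** Both composites are convolution inverses of the crossing by [b] on degree [a']. *)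
Lemma cross_antipode b a a' c c' (x : H a) : a' = a^-1 -> c = b * a * b^-1 ->
  c' = c^-1 ->
  Phi b c' (S a' x) = S c' (Phi b c x).
Proof.
move=> ea ec ec'; apply: esym; move: x.
have e : c' = b * a' * b^-1 by solve_degree.
apply: (@conv_uniq _ _ _ a a' (H c') _ _ (fun y => Phi b c' y)) => //;
  first [lin | move=> z].
  rewrite -(@comul_cross b 1 a a' 1 c c' z _ (fun u v => S c' u * v)) //;
    [|lin|solve_degree|solve_degree].
  by rewrite comul_antipl ?eps_cross //; solve_degree.
under sw_eq => u v do rewrite -crossM //.
rewrite -(sw_lin _ _ (g := fun q => Phi b c' q)); last by lin.
by rewrite comul_antipr ?linearZ ?cross1 //; solve_degree.
Qed.

End Crossing.

(** * The R-matrix *)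

Section Quasitriangular.
Variables (G : groupType) (k : fieldType).
Variable H : quasitriangular_hopf_pi_coalgebra G k.
Implicit Types a b c : G.
Local Open Scope group_scope.
Local Notation D := (@comul G k H _).
Local Notation S := (@antipode G k H _).
Local Notation eps := (eps H).
Local Notation Phi := (@cross G k H _).
Local Notation R := (Rmx H).

Lemma R_comul a b ab c (x : H ab) (W : lmodType k) (F : H a -> H b -> W) :
  bil F -> ab = a * b -> c = a * b * a^-1 ->
  sw (R a b) (fun p q => sw (D a b x) (fun y z => F (p * y) (q * z))) =
  sw (D c a x) (fun y z => sw (R a b) (fun p q => F (z * p)
    (Phi a^-1 b y * q))).
Proof.
move=> FB *; subst; rewrite -sw_mul // comulE Rmx_Delta sw_mul // sw_tflip;
  last by lin.
rewrite castA_transport sw_tmap; last by lin.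
apply: sw_eq => y z; apply: sw_eq => p q.
by rewrite cross_to.
Qed.

Lemma R_comulr a b c bc (W : lmodType k) (F : H a -> H b -> H c -> W) :
  tri F -> bc = b * c ->
  sw (R a bc) (fun p q => sw (D b c q) (fun y z => F p y z)) =
  sw (R a c) (fun p q => sw (R a b) (fun p' q' => F (p * p') q' q)).
Proof.
move=> FT ->.
pose Q (t : tensor (H a) (tensor (H b) (H c))) :=
  sw t (fun u y => sw y (fun v w => F u v w)).
have QL : lin Q by rewrite /Q; lin.
have QE u v w : Q (tens u (tens v w)) = F u v w.
  by rewrite /Q !swE; [|lin|lin].
have := congr1 Q (Rmx_Deltar H a b c).
rewrite [in X in X = _]/Q sw_tmap; last by lin.
under sw_eq => u v do rewrite -comulE /=.
rewrite -[in X in _ = X](sw_tens (R a c)) -[in X in _ =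
  X](sw_tens (R a b)) => E.
rewrite [LHS]E /leg13 (sw_lin _ _ (g := tmap _ _)); last by lin.
rewrite sw_mull (sw_lin _ _ QL); apply: sw_eq => p q.
rewrite /leg12 (sw_lin _ _ (g := fun t => tassoc (tens t _))); last by lin.
rewrite sw_mulr (sw_lin _ _ QL); apply: sw_eq => p' q'.
by rewrite tmapE tassocE !tens_mulE mulg1 mul1g QE.
Qed.

Lemma R_comull a b ab c c' (W : lmodType k) (F : H a -> H b -> H c -> W) :
  tri F -> ab = a * b -> c' = b * c * b^-1 ->
  sw (R ab c) (fun p q => sw (D a b p) (fun y z => F y z q)) =
  sw (R a c') (fun p q => sw (R b c) (fun p' q' => F p p' (Phi b^-1 c q * q'))).
Proof.
move=> FT -> ->.
pose Q (t : tensor (H a) (tensor (H b) (H c))) :=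
  sw t (fun u y => sw y (fun v w => F u v w)).
have QL : lin Q by rewrite /Q; lin.
have QE u v w : Q (tens u (tens v w)) = F u v w.
  by rewrite /Q !swE; [|lin|lin].
have := congr1 Q (Rmx_Deltal H a b c).
rewrite -[in X in X = _](sw_tens (R (a * b) c)).
rewrite (sw_lin _ _ (g := fun t => tassoc (tmap _ _ t))); last by lin.
rewrite (sw_lin _ _ QL).
rewrite -[in X in _ = X](sw_tens (R a _)) -[in X in _ =
  X](sw_tens (R b c)) => E.
transitivity (sw (R (a * b) c) (fun p q =>
    Q (tassoc (tmap (Delta H a b) idfun (tens p q))))).
  apply: sw_eq => p q; rewrite tmapE -comulE -[in RHS](sw_tens (D a b p)).
  rewrite (sw_lin _ _ (g := fun t => Q (tassoc (tens t _)))); last first.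
    by move=> d t t'; rewrite tensPl linearP QL.
  by apply: sw_eq => y z; rewrite tassocE QE.
rewrite E /leg13 (sw_lin _ _ (g := fun t => tmap _ _ (tmap _ _ t)));
  last by lin.
rewrite sw_mull (sw_lin _ _ QL); apply: sw_eq => p q.
rewrite /leg23 (sw_lin _ _ (g := fun t => tens _ t)); last by lin.
rewrite sw_mulr (sw_lin _ _ QL); apply: sw_eq => p' q'.
by rewrite !tmapE /tensl !tens_mulE mulg1 mul1g QE cross_to.
Qed.

Lemma R_cross b a c a' c' (W : lmodType k) (F : H a' -> H c' -> W) :
  bil F -> a' = b * a * b^-1 -> c' = b * c * b^-1 ->
  sw (R a' c') F = sw (R a c) (fun p q => F (Phi b a' p) (Phi b c' q)).
Proof.
move=> FB *; subst; rewrite -Rmx_crossing sw_tmap //.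
by apply: sw_eq => p q; rewrite !cross_crossing.
Qed.

(** Applying [eps] to the middle leg of the first hexagon, with both degrees equal to 1, gives R = R
    (z (x) 1), where z is the contraction of R by [eps]; cancelling R yields z = 1. *)
Lemma R_epsr a (W : lmodType k) (f : H a -> W) : lin f ->
  sw (R a 1) (fun p q => (eps q : k) *: f p) = f 1%g.
Proof.
move=> fL; pose z := sw (R a 1) (fun p q => (eps q : k) *: p).
have Rz : R a 1 * tens z (1%g : H 1) = R a 1.
  have := @R_comulr a 1 1 1 _ (fun p q1 q2 => (eps q1 : k) *: tens p q2).
  rewrite mulg1 => /(_ _ erefl) E; rewrite -[in RHS](sw_tens (R a 1)).
  transitivity (sw (R a 1) (fun p q => sw (R a 1) (fun p' q' =>
      (eps q' : k) *: tens (p * p')%g q))).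
    rewrite -[in LHS](sw_tens (R a 1)) sw_mull; apply: sw_eq => p q.
    rewrite /z (sw_lin _ _ (g := fun t => tens p q * tens t (1%g : H 1)));
      last by lin.
    apply: sw_eq => p' q'.
    rewrite (linZ (f := fun t => tens p q * tens t (1%g : H 1))); last by lin.
    by rewrite tens_mulE mulg1.
  rewrite -E; last by lin.
  apply: sw_eq => p q.
  by rewrite (comul_epsl q (f := fun q => tens p q)) //; lin.
have [r [_ rR]] := Rmx_invertible H a 1.
have {}Rz : tens z (1%g : H 1) = 1 by rewrite -[RHS]rR -Rz mulgA rR mul1g.
have FB : bil (fun (p : H a) (q : H 1) => (eps q : k) *: f p).
  by split=> ?; [apply: lin_scale|apply: lin_scalel; lin].
have [F FE _] := swP FB.
rewrite -[RHS]scale1r -[X in X *: _](eps1 H) -FE -tens_1E -Rz FE eps1 scale1r.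
by rewrite /z (sw_lin _ _ fL); apply: sw_eq => p q; rewrite linZ.
Qed.

(** As for [R_epsr], with [eps] on the first leg of the second hexagon and R cancelled on the
    right. *)
Lemma R_epsl c (W : lmodType k) (f : H c -> W) : lin f ->
  sw (R 1 c) (fun p q => (eps p : k) *: f q) = f 1%g.
Proof.
move=> fL; pose z := sw (R 1 c) (fun p q => (eps p : k) *: q).
have Rz : tens (1%g : H 1) z * R 1 c = R 1 c.
  have := @R_comull 1 1 1 c c _ (fun p1 p2 q => (eps p1 : k) *: tens p2 q).
  move=> E; rewrite -[in RHS](sw_tens (R 1 c)).
  transitivity (sw (R 1 c) (fun p q => sw (R 1 c) (fun p' q' =>
      (eps p : k) *: tens p' (Phi 1^-1 c q * q')%g))).
    rewrite -[in LHS](sw_tens (R 1 c)) sw_mulr sw_exchange;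
      apply: sw_eq => p' q'.
    rewrite /z (sw_lin _ _ (g := fun t => tens (1%g : H 1) t * tens p' q'));
      last by lin.
    apply: sw_eq => p q.
    rewrite (linZ (f := fun t => tens (1%g : H 1) t * tens p' q')); last by lin.
    by rewrite tens_mulE mul1g cross_id ?invg1.
  rewrite -E; [|lin|solve_degree|solve_degree].
  apply: sw_eq => p q.
  by rewrite (comul_epsl p (f := fun p => tens p q)) //; lin.
have [r [Rr _]] := Rmx_invertible H 1 c.
have {}Rz : tens (1%g : H 1) z = 1 by rewrite -[RHS]Rr -Rz -mulgA Rr mulg1.
have FB : bil (fun (p : H 1) (q : H c) => (eps p : k) *: f q).
  by split=> ?; [apply: lin_scalel; lin|apply: lin_scale].
have [F FE _] := swP FB.
rewrite -[RHS]scale1r -[X in X *: _](eps1 H) -FE -tens_1E -Rz FE eps1 scale1r.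
by rewrite /z (sw_lin _ _ fL); apply: sw_eq => p q; rewrite linZ.
Qed.

(** * The inverse of R and the action of the antipode on R *)

Definition Rinv a a' b : tensor (H a) (H b) :=
  sw (R a' b) (fun p q => tens (S a (Phi a a' p)) q).

(** The second hexagon in degrees [a'] and [a], with the antipode axiom on its first two legs,
    reduces to [R_epsl]. Crossing invariance by [a] absorbs the twist in the hexagon, which accounts
    for the crossing in [Rinv]. *)
Lemma Rinv_l a a' b : a' = a^-1 -> Rinv a a' b * R a b = 1.
Proof.
move=> ea.
rewrite -[in LHS](sw_tens (R a b)) sw_mull.
rewrite [RHS]tens_1E -(R_epsl (f := fun q => tens (1%g : H a) q)); last by lin.
transitivity (sw (R 1 b) (fun p q => sw (D a' a p)
  (fun y z => tens (S a y * z)%g q))).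
  rewrite (@R_comull a' a 1 b (a * b * a^-1)); [|lin|solve_degree|solve_degree].
  rewrite [RHS](@R_cross a a' b a' (a * b * a^-1));
    [|lin|solve_degree|solve_degree].
  apply: sw_eq => p q; rewrite sw_mulr; apply: sw_eq => p' q'.
  by rewrite tens_mulE crossK ?mulVg.
apply: sw_eq => p q; rewrite -(sw_lin _ _ (g := fun t => tens t q));
  last by lin.
by rewrite comul_antipl // (linZ (f := fun t => tens t q)) //; lin.
Qed.

Lemma Rinv_r a a' b : a' = a^-1 -> R a b * Rinv a a' b = 1.
Proof.
move=> ea.
have [r [Rr rR]] := Rmx_invertible H a b.
by rewrite -[Rinv a a' b]mulg1 -Rr (mulgA (Rinv a a' b)) Rinv_l ?mul1g.
Qed.

(** The first hexagon with inverse degrees on the second leg turns the two copies of R into one; the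
    antipode axiom and [R_epsr] then contract it. [R_mul_antipr] is the mirror image. *)
Lemma R_mul_antipl a b b' (W : lmodType k) (F : H a -> H b -> W) : b' = b^-1 ->
  bil F ->
  sw (R a b) (fun p q => sw (R a b') (fun p' q' => F (p * p') (S b q' * q))) =
    F 1 1.
Proof.
move=> eb FB.
rewrite -(@R_comulr a b' b 1 _ (fun p q1 q2 => F p (S b q1 * q2)));
  [|lin|solve_degree].
rewrite -(R_epsr (f := fun p => F p 1)); last by lin.
apply: sw_eq => p q; rewrite -(sw_lin _ _ (g := F p)); last by lin.
by rewrite comul_antipl // (linZ (f := F p)) //; lin.
Qed.

Lemma R_mul_antipr a b b' (W : lmodType k) (F : H a -> H b -> W) : b' = b^-1 ->
  bil F ->
  sw (R a b') (fun p q => sw (R a b) (fun p' q' => F (p * p') (q' * S b q))) =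
    F 1 1.
Proof.
move=> eb FB.
rewrite -(@R_comulr a b b' 1 _ (fun p q1 q2 => F p (q1 * S b q2)));
  [|lin|solve_degree].
rewrite -(R_epsr (f := fun p => F p 1)); last by lin.
apply: sw_eq => p q; rewrite -(sw_lin _ _ (g := F p)); last by lin.
by rewrite comul_antipr // (linZ (f := F p)) //; lin.
Qed.

Lemma RinvE a a' b (W : lmodType k) (F : H a -> H b -> W) : bil F ->
  sw (Rinv a a' b) F = sw (R a' b) (fun p q => F (S a (Phi a a' p)) q).
Proof.
move=> FB; rewrite /Rinv (sw_lin _ _ (g := fun t => sw t F)); last by lin.
by apply: sw_eq => p q; rewrite swE.
Qed.

(* Both sides invert (id (x) S) R a b in the algebra H a (x) (H b^-1)^op. *)
Lemma R_antipode a a' b b' (W : lmodType k) (F : H a -> H b' -> W) :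
  a' = a^-1 -> b' = b^-1 -> bil F ->
  sw (R a b') F = sw (R a' b) (fun p q => F (S a (Phi a a' p)) (S b' q)).
Proof.
move=> ea eb FB.
rewrite -(@RinvE a a' b _ (fun p q => F p (S b' q))); last by lin.
(* In l p r (x) s S(q) S(m), contracting [Rinv] with [R a b] leaves the left side, and contracting p
   r (x) s S(q) leaves the right side. *)
transitivity (sw (Rinv a a' b) (fun l m => sw (R a b) (fun p q =>
    sw (R a b') (fun r s => F (l * p * r) (s * (S b' q * S b' m)))))).
  transitivity (sw (Rinv a a' b * R a b) (fun x y =>
      sw (R a b') (fun r s => F (x * r) (s * S b' y)))).
    rewrite Rinv_l // tens_1E swE; last by lin.
    by apply: sw_eq => r s; rewrite antipode1 // mul1g mulg1.
  rewrite sw_mul; last by lin.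
  apply: sw_eq => l m; apply: sw_eq => p q; apply: sw_eq => r s.
  by rewrite antipodeM.
apply: sw_eq => l m.
have eb' : b = b'^-1 by solve_degree.
rewrite -[in RHS](mulg1 l) -[in RHS](mul1g (S b' m)).
rewrite -(@R_mul_antipr a b' b _ (fun p q => F (l * p) (q * S b' m))) //;
  last by lin.
by apply: sw_eq => p q; apply: sw_eq => r s; rewrite !mulgA.
Qed.

(** Two applications of [R_antipode], in degrees [a] and [a'], introduce crossings by [a] and by its
    inverse, which cancel. *)
Lemma R_antipode2 a b (a' b' : G) (W : lmodType k) (F : H a -> H b -> W) :
  a' = a^-1 -> b' = b^-1 -> bil F ->
  sw (R a b) (fun p q => F (S a (S a' p)) (S b (S b' q))) = sw (R a b) F.
Proof.
move=> ea eb FB.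
have ea' : a = a'^-1 by solve_degree.
have eb' : b = b'^-1 by solve_degree.
rewrite [RHS](@R_antipode a a' b' b) // (@R_antipode a' a b b');
  [|solve_degree|solve_degree|lin].
apply: sw_eq => p q.
rewrite (@cross_antipode _ _ _ _ a a' a a') //; last by solve_degree.
by rewrite crossK //; solve_degree.
Qed.

End Quasitriangular.

(** * Drinfeld elements *)

Section Drinfeld.
Variables (G : groupType) (k : fieldType).
Variable H : quasitriangular_hopf_pi_coalgebra G k.
Implicit Types a b c : G.
Local Open Scope group_scope.
Local Notation D := (@comul G k H _).
Local Notation S := (@antipode G k H _).
Local Notation eps := (eps H).
Local Notation Phi := (@cross G k H _).
Local Notation R := (Rmx H).
Local Notation u := (drinfeld H).

Lemma drinfeldE a a' : a' = a^-1 ->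
  u a = sw (R a a') (fun p q => S a (Phi a a' q) * p).
Proof.
move=> ->.
rewrite /drinfeld -[in LHS](sw_tens (R a a^-1)).
rewrite (sw_lin _ _ (g := fun t => amul_map _ (tmap _ _ (tflip t))));
  last by lin.
apply: sw_eq => p q; rewrite tflipE tmapE amul_mapE antipode_antipV;
  congr (_ * _).
by rewrite -(cross_to (conj_invself a)).
Qed.

Lemma drinfeld_mul a (x : H a) : u a * x = S a (S a^-1 (Phi a a x)) * u a.
Proof.
pose a' := a^-1; have e : a' = a^-1 by [].
(* The product x2 S(x3) is inserted next to q in place of a counit; applying S and the crossing
   sends the factor coming from x3 to the far left. *)
transitivity (sw (D a 1 x) (fun x1 y => sw (D a' a y) (fun x2 x3 =>
    sw (R a a') (fun p q =>
    S a (S a' (Phi a a x3)) * S a (Phi a a' (q * x2)) * (p * x1))))).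
  rewrite -[in LHS](comul_epsr x (f := fun x => u a * x)); last by lin.
  apply: sw_eq => x1 y; rewrite sw_exchange (drinfeldE e) sw_mull.
  rewrite (sw_lin _ _ (g := fun t => (eps y : k) *: t)); last by lin.
  apply: sw_eq => p q.
  transitivity (S a (Phi a a' (q * sw (D a' a y) (fun x2 x3 => x2 * S a' x3)))
    * (p * x1)).
    by rewrite comul_antipr -?ascalerAr ?mulg1 ?linearZ -?ascalerAl ?mulgA //;
      solve_degree.
  rewrite sw_mulr (sw_lin _ _ (g := fun t => S a (Phi a a' t) * (p * x1)));
    last by lin.
  apply: sw_eq => x2 x3.
  rewrite (mulgA q) crossM; last by solve_degree.
  rewrite antipodeM; last by solve_degree.
  by rewrite (@cross_antipode _ _ _ _ _ _ a a') //; solve_degree.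
rewrite -(@comulA _ _ _ 1 1 _ a a' a);
  [|lin|solve_degree|solve_degree|solve_degree].
rewrite -[in RHS](comul_epsl x (f := fun x => S a (S a' (Phi a a x)) * u a));
  last by lin.
apply: sw_eq => y x3.
transitivity (sw (R a a') (fun p q => sw (D a a' y) (fun x1 x2 =>
    S a (S a' (Phi a a x3)) * S a (Phi a a' (q * x2)) * (p * x1)))).
  by rewrite sw_exchange.
(* Once R has passed x1 and x2, they appear between S(phi q) and p as a product S(x1) x2 in the new
   numbering, which contracts. *)
rewrite (@R_comul _ _ _ a a' 1 a' _ _ (fun s t =>
  S a (S a' (Phi a a x3)) * S a (Phi a a' t) * s));
    [|lin|solve_degree|solve_degree].
rewrite sw_exchange (drinfeldE e) sw_mulr.
rewrite (sw_lin _ _ (g := fun t => (eps y : k) *: t)); last by lin.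
apply: sw_eq => p q.
transitivity (S a (S a' (Phi a a x3)) * S a (Phi a a' q) *
    sw (D a' a y) (fun x1 x2 => S a x1 * x2) * p).
  rewrite sw_mulr sw_mull; apply: sw_eq => x1 x2.
  rewrite crossM; last by solve_degree.
  rewrite antipodeM; last by solve_degree.
  by rewrite crossK ?mulgV ?mulgA //; solve_degree.
by rewrite comul_antipl // -ascalerAr mulg1 -ascalerAl !mulgA.
Qed.

Definition drinfeld_inv a : H a := sw (R a a) (fun p q => q * S a (S a^-1 p)).
Local Notation v := drinfeld_inv.

Lemma drinfeld_invE a :
  v a = amul_map (H a) (tmap idfun (antipV H a \o antip H a) (tflip (R a a))).
Proof.
rewrite -[in RHS](sw_tens (R a a)).
rewrite (sw_lin _ _ (g := fun t => amul_map _ (tmap _ _ (tflip t))));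
  last by lin.
by apply: sw_eq => p q; rewrite tflipE tmapE amul_mapE antipode_antipV
  antipode_antip.
Qed.

(** R is invariant both under the crossing by [a] and under S^2 on both legs. This invariance is
    what makes the right inverse of [u a] also a left inverse. *)
Lemma antipode2_drinfeld_inv a : S a (S a^-1 (Phi a a (v a))) = v a.
Proof.
rewrite [RHS](@R_cross _ _ _ a a a a a _ (fun p q => q * S a (S a^-1 p)));
  [|lin|solve_degree|solve_degree].
rewrite -[RHS](@R_antipode2 _ _ _ a a a^-1 a^-1 _ (fun p q =>
  Phi a a q * S a (S a^-1 (Phi a a p)))) //; last by lin.
rewrite /v (sw_lin _ _ (g := fun t => S a (S a^-1 (Phi a a t)))); last by lin.
apply: sw_eq => p q.
rewrite crossM ?(antipodeM (a' := a^-1)) // ?antipodeM;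
  [|solve_degree|solve_degree].
by rewrite !(@cross_antipode _ _ _ a a a^-1 a a^-1,
  @cross_antipode _ _ _ a a^-1 a a^-1 a) //; solve_degree.
Qed.

Lemma drinfeld_mulV a : u a * v a = 1.
Proof.
pose a' := a^-1; have e : a' = a^-1 by [].
rewrite /v sw_mulr.
(* [drinfeld_mul] moves [u a] past q', turning q' into S^2(phi q'), which is then merged with S(phi
   q). *)
transitivity (sw (R a a') (fun p q => sw (R a a) (fun p' q' =>
   S a (Phi a a' (q * S a' q')) * (p * S a (S a' p'))))).
  rewrite sw_exchange; apply: sw_eq => p' q'.
  rewrite mulgA drinfeld_mul (drinfeldE e) sw_mulr sw_mull; apply: sw_eq => p q.
  rewrite crossM; last by solve_degree.
  rewrite antipodeM; last by solve_degree.
  rewrite (@cross_antipode _ _ _ a a a' a a') //; last by solve_degree.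
  by rewrite !mulgA.
(* By [R_antipode], S^2(p') (x) S(q') summed over [R a a] is exactly the inverse of [R a a']. *)
transitivity (sw (R a a' * Rinv H a a' a') (fun x y => S a (Phi a a' y) * x)).
  rewrite sw_mul; last by lin.
  apply: sw_eq => p q; rewrite RinvE; last by lin.
  rewrite (@R_antipode _ _ _ a' a a a'); [|solve_degree|by []|lin].
  apply: sw_eq => p' q'; rewrite (@cross_antipode _ _ _ _ _ _ a a') //;
    last by solve_degree.
  by rewrite crossK ?mulgV //; solve_degree.
rewrite Rinv_r // tens_1E swE; last by lin.
by rewrite cross1 ?antipode1 ?mulg1 //; solve_degree.
Qed.

Lemma drinfeld_inverse a : inverse_of (u a) (v a).
Proof.
split; first exact: drinfeld_mulV.
by rewrite -[X in X * _]antipode2_drinfeld_inv -drinfeld_mul drinfeld_mulV.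
Qed.

Lemma antipode2_conj a a' (x : H a) : a' = a^-1 ->
  S a (S a' (Phi a a x)) = u a * x * v a.
Proof. by move=> ->; rewrite drinfeld_mul -mulgA drinfeld_mulV mulg1. Qed.

(** S^2 is a crossing followed by conjugation by [u a], hence injective. *)
Lemma antipode_inj a a' : a' = a^-1 -> injective (fun x : H a => S a' x).
Proof.
move=> e x y E; have [uv vu] := drinfeld_inverse a.
have SSE (z : H a) : S a (S a' z) = u a * Phi a^-1 a z * v a.
  by rewrite -(antipode2_conj _ e) // crossK ?mulgV //; solve_degree.
have := congr1 (fun z => v a * S a z * u a) E.
rewrite !SSE !mulgA vu !mul1g -!mulgA vu !mulg1 => /(congr1 (Phi a a)).
by rewrite !crossK ?mulgV //; solve_degree.
Qed.

(** In degree [a'], S^2 phi is conjugation by [u a'], so the preimage is obtained by undoing that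
    conjugation and applying all of S^2 phi except the last antipode. *)
Lemma antipode_surj a a' (y : H a') : a' = a^-1 -> exists x : H a, S a' x = y.
Proof.
move=> e; have [uv vu] := drinfeld_inverse a'.
exists (S a (Phi a' a' (v a' * y * u a'))).
rewrite antipode2_conj; last by solve_degree.
by rewrite !mulgA uv mul1g -mulgA uv mulg1.
Qed.

Lemma antip_bij a : bijective (antip H a).
Proof.
have /choice[g gK] : forall y : H a^-1, exists x : H a, antip H a x = y.
  by move=> y; have [x] := @antipode_surj a _ y erefl; rewrite antipode_antip;
    exists x.
exists g => // x.
by have := @antipode_inj a a^-1 erefl (g (antip H a x)) x;
  rewrite !antipode_antip gK; exact.
Qed.

Lemma cross_drinfeld b a a' : a' = b * a * b^-1 -> Phi b a' (u a) = u a'.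
Proof.
move=> e; rewrite !(drinfeldE erefl).
rewrite (sw_lin _ _ (g := fun t => Phi b a' t)); last by lin.
rewrite [RHS](@R_cross _ _ _ b a a^-1); [|lin|solve_degree|solve_degree].
apply: sw_eq => p q; rewrite crossM //.
rewrite (@cross_antipode _ _ _ b a^-1 a a'^-1 a');
  [|solve_degree|solve_degree|solve_degree].
rewrite !cross_comp; [|solve_degree|solve_degree].
(* The two composite crossings agree because b a = (b a b^-1) b. *)
by congr (S _ (Phi _ _ _) * _); solve_degree.
Qed.

(** The counit absorbs both the antipode and the crossing, leaving [eps] on both legs of [R 1 1]. *)
Lemma eps_drinfeld : eps (u 1) = 1%R.
Proof.
rewrite (@drinfeldE 1 1) ?invg1 // (sw_lin _ _ (g := eps)); last by lin.
rewrite -[RHS](eps1 H) -(R_epsr (f := eps)); last by lin.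
by apply: sw_eq => p q; rewrite epsM eps_antipode eps_cross.
Qed.

(** The element [u a] is fixed by the crossing by [a] and commutes with itself. *)
Lemma antipode2_drinfeld a a' : a' = a^-1 -> S a (S a' (u a)) = u a.
Proof.
move=> e; have [uv _] := drinfeld_inverse a.
rewrite -[X in S a' X](@cross_drinfeld a a a); last by solve_degree.
by rewrite antipode2_conj // -mulgA uv mulg1.
Qed.

(** [drinfeld_mul] moves [u a] past S(u a'), which is fixed by the crossing by [a] and by S^2. *)
Lemma drinfeld_antipode_comm a a' : a' = a^-1 -> S a (u a') * u a =
  u a * S a (u a').
Proof.
move=> e; rewrite drinfeld_mul -e.
rewrite (@cross_antipode _ _ _ a a' a a' a) ?cross_drinfeld ?antipode2_drinfeld
  //; solve_degree.
Qed.

(** By surjectivity, phi(x) = S(y) with y of degree [a']. Applying S to the commutation rule of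
    [u a'] with y moves S(u a') across phi(x), and the rule for [u a] handles the other factor. *)
Lemma drinfeld_antipode_cross a a' (x : H a) : a' = a^-1 ->
  S a (u a') * u a * Phi a' a x = Phi a a x * (S a (u a') * u a).
Proof.
move=> e; have e' : a = a'^-1 by solve_degree.
have [y yE] := antipode_surj (Phi a a x) e'.
have /(congr1 (S a)) := drinfeld_mul y; rewrite -e' !antipodeM // yE => E.
rewrite mulgA E -[in LHS]mulgA drinfeld_mul -e !mulgA; congr (_ * _ * _).
rewrite crossK; [|solve_degree|solve_degree].
rewrite -(@cross_antipode _ _ _ a' a' a a' a) ?yE;
  [|solve_degree|solve_degree|solve_degree].
by rewrite crossK //; solve_degree.
Qed.

End Drinfeld.

(** * Coproduct of the Drinfeld elements *)

Section DrinfeldDelta.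
Variables (G : groupType) (k : fieldType).
Variable H : quasitriangular_hopf_pi_coalgebra G k.
Implicit Types a b c : G.
Local Open Scope group_scope.
Local Notation D := (@comul G k H _).
Local Notation S := (@antipode G k H _).
Local Notation eps := (eps H).
Local Notation Phi := (@cross G k H _).
Local Notation R := (Rmx H).
Local Notation u := (drinfeld H).

(** Both sides compute R_{a,b} times the coproduct of the first leg of R_{ab,c}: the left by the
    second hexagon alone, the right by first exchanging R_{a,b} with the coproduct. *)
Lemma yang_baxter a b c c' (W : lmodType k) (F : H a -> H b -> H c -> W) :
  tri F -> c' = b * c * b^-1 ->
  sw (R a b) (fun e f => sw (R a c') (fun x y => sw (R b c) (fun z w =>
    F (e * x) (f * z) (Phi b^-1 c y * w)))) =
  sw (R b c) (fun z w => sw (R a c) (fun x y => sw (R a b) (fun e f =>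
    F (x * e) (z * f) (w * y)))).
Proof.
move=> FT ->.
transitivity (sw (R (a * b) c) (fun p q => sw (R a b) (fun e f =>
    sw (D a b p) (fun x z => F (e * x) (f * z) q)))).
  rewrite [RHS]sw_exchange; apply: sw_eq => e f.
  by rewrite (@R_comull _ _ _ a b (a * b) c (b * c * b^-1) _ (fun x z q => F (e
    * x) (f * z) q)) //; lin.
transitivity (sw (R (a * b) c) (fun p q => sw (D (a * b * a^-1) a p) (fun z x =>
    sw (R a b) (fun e f => F (x * e) (Phi a^-1 b z * f) q)))).
  apply: sw_eq => p q.
  by rewrite (@R_comul _ _ _ a b (a * b)
    (a * b * a^-1) _ _ (fun x z => F x z q)) //; lin.
rewrite (@R_comull _ _ _ (a * b * a^-1) a _ c (a * c * a^-1) _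
  (fun z x q => sw (R a b) (fun e f => F (x * e) (Phi a^-1 b z * f) q)));
  [|lin|solve_degree|solve_degree].
rewrite (@R_cross _ _ _ a b c); [|lin|solve_degree|solve_degree].
apply: sw_eq => z w; apply: sw_eq => x y; apply: sw_eq => e f.
by rewrite !crossK ?mulVg.
Qed.

(** The first factor of the double braiding P = [R21 a b * R a b] that corrects the coproduct of the
    Drinfeld elements. *)
Definition R21 a b : tensor (H a) (H b) :=
  sw (R b a) (fun p q => tens (Phi a a q) p).

Lemma sw_R21 a b (W : lmodType k) (F : H a -> H b -> W) : bil F ->
  sw (R21 a b) F = sw (R b a) (fun p q => F (Phi a a q) p).
Proof.
move=> FB; rewrite /R21 (sw_lin _ _ (g := fun t => sw t F)); last by lin.
by apply: sw_eq => p q; rewrite swE.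
Qed.

(** Quasi-cocommutativity is used twice, for [R a b] and then for [R b a]; two flips restore the
    order of the legs and only crossings remain. *)
Lemma R21_comul a b c (x : H c) : c = a * b ->
  R21 a b * R a b * D a b (Phi c c x) =
  sw (D a b x) (fun y z => tens (Phi a a y) (Phi b b z)) * (R21 a b * R a b).
Proof.
move=> ec; pose d := a * b * a^-1.
have RD (w : H c) : R a b * D a b w =
    sw (D d a w) (fun y z => tens z (Phi a^-1 b y)) * R a b.
  rewrite -[in LHS](sw_tens (R a b)) -[in LHS](sw_tens (D a b w)) sw_mull.
  under sw_eq => p q do rewrite sw_mulr.
  under sw_eq => p q do under sw_eq => y z do rewrite tens_mulE.
  rewrite (@R_comul _ _ _ a b c d); [|lin|solve_degree|solve_degree].
  rewrite sw_mull; apply: sw_eq => y z; rewrite -[in RHS](sw_tens (R a b))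
    sw_mulr.
  by apply: sw_eq => p q; rewrite tens_mulE.
rewrite -mulgA RD !mulgA; congr (_ * _).
(* The crossing by ab splits as phi_a phi_b; phi_b(x) lies in degree ba, where the exchange with
   [R b a] applies. *)
pose w := Phi b (b * a) x.
have -> : Phi c c x = Phi a c w.
  by rewrite /w cross_comp ?ec //; solve_degree.
rewrite (@comul_cross _ _ H a (b * a) b a);
  [|lin|solve_degree|solve_degree|solve_degree|solve_degree].
rewrite {1}/R21 sw_mull.
transitivity (sw (R b a) (fun p q => sw (D b a w) (fun y z =>
    tens (Phi a a (q * z)) (p * y)%g))).
  apply: sw_eq => p q; rewrite sw_mulr; apply: sw_eq => y z.
  by rewrite tens_mulE crossM ?crossK ?mulVg //; solve_degree.
rewrite (@R_comul _ _ _ b a _ (b * a * b^-1) _ _ (fun s t => tens (Phi a a t)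
  s));
  [|lin|solve_degree|solve_degree].
rewrite /w (@comul_cross _ _ H b c a b);
  [|lin|solve_degree|solve_degree|solve_degree|solve_degree].
rewrite sw_mull; apply: sw_eq => y z; rewrite /R21 sw_mulr; apply: sw_eq => p q.
by rewrite tens_mulE crossK ?crossM ?mulVg //; solve_degree.
Qed.

Lemma comul_drinfeld a b c : c = a * b ->
  R21 a b * R a b * D a b (u c) = tens (u a) (u b).
Proof.
move=> ec.
have [a' ea] : {a' | a' = a^-1} by exists a^-1.
have [b' eb] : {b' | b' = b^-1} by exists b^-1.
have ea' : a = a'^-1 by solve_degree.
have eb' : b = b'^-1 by solve_degree.
have ca : a = a * a * a^-1 by solve_degree.
have cb : b = b * b * b^-1 by solve_degree.
have [c' ec'] : {c' | c' = c^-1} by exists c^-1.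
(* The general summand: m, n are the legs of P, p1, p2 those of the coproduct of p, and q1, q2 those
   of the coproduct of q, whose order the antipode reverses. *)
pose T (m : H a) (n : H b) (p1 : H a) (p2 : H b) (q1 : H b') (q2 : H a') :=
  tens (Phi a a (S a q2) * (m * p1))%g (Phi b b (S b q1) * (n * p2))%g.
transitivity (sw (R21 a b * R a b) (fun m n => sw (R c c') (fun p q =>
    sw (D b' a' q) (fun q1 q2 => sw (D a b p)
      (fun p1 p2 => T m n p1 p2 q1 q2))))).
  rewrite (drinfeldE H ec').
  rewrite (sw_lin _ _ (g := fun t => R21 a b * R a b * D a b t)); last by lin.
  rewrite [RHS]sw_exchange.
  apply: sw_eq => p q; rewrite comulM // mulgA.
  rewrite -(@cross_antipode _ _ _ c c' c c' c);
    [|solve_degree|solve_degree|solve_degree].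
  rewrite R21_comul // (@comul_antipode _ _ H c' b' a' c b a);
    [|lin|solve_degree|solve_degree|solve_degree|solve_degree].
  rewrite [RHS]sw_exchange -mulgA sw_mull; apply: sw_eq => q1 q2.
  rewrite -[in LHS](sw_tens (D a b p)) -[in LHS](sw_tens (R21 a b * R a b)).
  rewrite sw_mull sw_mulr; apply: sw_eq => m n.
  rewrite !sw_mulr; apply: sw_eq => p1 p2.
  by rewrite !tens_mulE.
(* The hexagons split [R c c'] into four copies of R, and P contributes two more. *)
transitivity (sw (R b a) (fun f f' => sw (R a b) (fun e e' =>
    sw (R a (b * a' * b^-1)) (fun x x' => sw (R b a') (fun y y' =>
    sw (R a b') (fun z z' => sw (R b b') (fun w w' =>
    T (Phi a a f' * e) (f * e') (x * z) (y * w) (Phi b^-1 b' z' * w')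
      (Phi b^-1 a' x' * y')))))))).
  rewrite sw_mul; last by rewrite /T; lin.
  rewrite sw_R21; last by rewrite /T; lin.
  apply: sw_eq => f f'.
  apply: sw_eq => e e'; set m := Phi a a f' * e; set n := f * e'.
  rewrite (@R_comulr _ _ _ c b' a' c' _ (fun p q1 q2 =>
    sw (D a b p) (fun p1 p2 => T m n p1 p2 q1 q2))); [|rewrite /T;
      lin|solve_degree].
  transitivity (sw (R c a') (fun p q => sw (D a b p) (fun x y =>
      sw (R c b') (fun p' q' => sw (D a b p') (fun z w =>
      T m n (x * z) (y * w) q' q))))).
    apply: sw_eq => p q; rewrite [RHS]sw_exchange; apply: sw_eq => p' q'.
    by rewrite comulM // sw_mul //; rewrite /T; lin.
  rewrite (@R_comull _ _ _ a b c a' (b * a' * b^-1) _ (fun x y q =>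
      sw (R c b') (fun p' q' => sw (D a b p') (fun z w =>
      T m n (x * z) (y * w) q' q)))); [|rewrite /T;
        lin|solve_degree|solve_degree].
  apply: sw_eq => x x'; apply: sw_eq => y y'.
  rewrite (@R_comull _ _ _ a b c b' b' _ (fun z w q' =>
    T m n (x * z) (y * w) q' (Phi b^-1 a' x' * y'))); [by []|rewrite /T;
      lin|solve_degree|solve_degree].
(* Yang-Baxter reorders the copies named e, x, y. Afterwards f s faces S(s') f', and e z faces S(z')
   e', the two patterns that [R_mul_antipl] cancels. *)
transitivity (sw (R b a) (fun f f' => sw (R b a') (fun s s' =>
    sw (R a a') (fun t t' => sw (R a b) (fun e e' =>
    sw (R a b') (fun z z' => sw (R b b') (fun w w' =>
    tens (Phi a a (S a t') * Phi a a (S a s' * f') * (t * (e * z)))%g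
      (Phi b b (S b w') * (S b z' * (f * s) * e') * w)%g))))))).
  apply: sw_eq => f f'.
  pose F x y q := sw (R a b') (fun z z' => sw (R b b') (fun w w' =>
    T (Phi a a f') f (x * z) (y * w) (Phi b^-1 b' z' * w') q)).
  transitivity (sw (R a b) (fun e e' => sw (R a (b * a' * b^-1)) (fun x x' =>
    sw (R b a') (fun y y' => F (e * x) (e' * y) (Phi b^-1 a' x' * y'))))).
    apply: sw_eq => e e'; apply: sw_eq => x x'; apply: sw_eq => y y'.
    apply: sw_eq => z z'; apply: sw_eq => w w'; rewrite /T !mulgA //.
  rewrite yang_baxter //; last by rewrite /F /T; lin.
  apply: sw_eq => s s'; apply: sw_eq => t t'; apply: sw_eq => e e'.
  apply: sw_eq => z z'; apply: sw_eq => w w'; rewrite /T.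
  rewrite !antipodeM // !crossM // (@cross_antipode _ _ _ b b' b b' b (Phi b^-1
    b' z')) //; last by solve_degree.
  by rewrite crossK ?mulgV ?mulgA //; solve_degree.
(* First cancellation, of the copies f and s. *)
rewrite (@R_mul_antipl _ _ _ b a a' _ (fun f f' => sw (R a a') (fun t t' =>
    sw (R a b) (fun e e' => sw (R a b') (fun z z' => sw (R b b') (fun w w' =>
    tens (Phi a a (S a t') * Phi a a f' * (t * (e * z)))%g
      (Phi b b (S b w') * (S b z' * f * e') * w)%g)))))) //; last by lin.
transitivity (sw (R a a') (fun t t' => sw (R b b') (fun w w' =>
    tens (Phi a a (S a t') * t)%g (Phi b b (S b w') * w)%g))).
  apply: sw_eq => t t'.
  transitivity (sw (R a b) (fun e e' => sw (R a b') (fun z z' =>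
    sw (R b b') (fun w w' =>
    tens (Phi a a (S a t') * (t * (e * z)))%g
      (Phi b b (S b w') * (S b z' * e') * w)%g)))).
    apply: sw_eq => e e'; apply: sw_eq => z z'; apply: sw_eq => w w'.
    by rewrite cross1 // !mulg1.
  (* Second cancellation, of e and z; the remaining copies t and w give [u a] and [u b]. *)
  rewrite (@R_mul_antipl _ _ _ a b b' _ (fun x y => sw (R b b') (fun w w' =>
    tens (Phi a a (S a t') * (t * x))%g (Phi b b (S b w') * y * w)%g))) //;
      last by lin.
  by apply: sw_eq => w w'; rewrite !mulg1.
rewrite (drinfeldE H ea) (drinfeldE H eb).
rewrite [RHS](sw_lin _ _ (g := fun t => tens t _)); last by lin.
apply: sw_eq => t t'.
rewrite [RHS](sw_lin _ _ (g := fun s => tens _ s)); last by lin.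
apply: sw_eq => w w'.
by rewrite (@cross_antipode _ _ _ a a' a a' a) ?(@cross_antipode _ _ _ b b' b
  b' b) //; solve_degree.
Qed.

(** Flipping and then crossing one leg is multiplicative and unital, so it carries the inverse of
    [R b a] to an inverse of [R21 a b]. *)
Lemma R21_inverse a b : exists r, inverse_of (R21 a b) r.
Proof.
have [r [Rr rR]] := Rmx_invertible H b a.
pose f (t : tensor (H b) (H a)) := sw t (fun p q => tens (Phi a a q) p).
have fM s t : f (s * t) = f s * f t.
  rewrite /f sw_mul; last by lin.
  rewrite sw_mull; apply: sw_eq => p q; rewrite sw_mulr; apply: sw_eq => p' q'.
  by rewrite tens_mulE crossM //; solve_degree.
have f1 : f 1 = 1 by rewrite /f tens_1E swE; [rewrite cross1 //;
  solve_degree|lin].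
by exists (f r); rewrite /R21 -/(f _); split; rewrite -fM ?Rr ?rR f1.
Qed.

(** This is the image of P under phi_{a^-1} (x) phi_{b^-1}. *)
Definition Qmx a b : tensor (H a) (H b) :=
  sw (R b a) (fun p q => tens q (Phi b^-1 b p)) *
  sw (R a b) (fun p q => tens (Phi a^-1 a p) (Phi b^-1 b q)).

(** Conjugation by u_a (x) u_b is S^2 phi on each leg. On [Qmx] the crossings cancel, and S^2 (x)
    S^2 fixes each factor of P. *)
Lemma Qmx_conj a b :
  tens (u a) (u b) * Qmx a b = R21 a b * R a b * tens (u a) (u b).
Proof.
pose f (t : tensor (H a) (H b)) := sw t (fun p q =>
  tens (S a (S a^-1 (Phi a a p))) (S b (S b^-1 (Phi b b q)))).
have fL : lin f by rewrite /f; lin.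
have fu t : tens (u a) (u b) * t = f t * tens (u a) (u b).
  rewrite -[in LHS](sw_tens t) sw_mulr /f sw_mull; apply: sw_eq => p q.
  by rewrite !tens_mulE !drinfeld_mul.
have fM s t : f (s * t) = f s * f t.
  rewrite /f sw_mul; last by lin.
  rewrite sw_mull; apply: sw_eq => p q; rewrite sw_mulr; apply: sw_eq => p' q'.
  rewrite tens_mulE !crossM; [|solve_degree|solve_degree].
  by rewrite !(antipodeM (a' := _^-1)) // !antipodeM //; solve_degree.
have fE p q : f (tens p q) =
    tens (S a (S a^-1 (Phi a a p))) (S b (S b^-1 (Phi b b q))).
  by rewrite /f swE //; lin.
rewrite fu fM; congr (_ * _ * _).
  rewrite (sw_lin _ _ fL) /R21.
  rewrite -[RHS](@R_antipode2 _ _ _ b a b^-1 a^-1 _ (fun p q => tens (Phi a a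
    q) p)) //; last by lin.
  apply: sw_eq => p q; rewrite fE crossK ?mulgV; [|by []|solve_degree].
  by rewrite (@cross_antipode _ _ _ a a^-1 a a^-1 a) ?(@cross_antipode _ _ _ a
    a a^-1 a a^-1) //; solve_degree.
rewrite (sw_lin _ _ fL) -[RHS](sw_tens (R a b)).
rewrite -[RHS](@R_antipode2 _ _ _ a b a^-1 b^-1 _ (fun p q => tens p q)) //;
  last by lin.
by apply: sw_eq => p q; rewrite fE !crossK ?mulgV //; solve_degree.
Qed.

End DrinfeldDelta.

(** * Inverses in a monoid, and the passage to the stated formulas *)

Section Units.
Variable A : monoidType.
Local Open Scope group_scope.

Lemma invertibleM (x y : A) : invertible x -> invertible y ->
  invertible (x * y).
Proof.
move=> [x' [xx' x'x]] [y' [yy' y'y]]; exists (y' * x').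
split; first by rewrite mulgA -(mulgA x) yy' mulg1.
by rewrite mulgA -(mulgA y') x'x mulg1.
Qed.

Lemma eq_minv_mul (x y z : A) : invertible x -> x * y = z -> y = minv x * z.
Proof. by move=> /minvP[_ xK] <-; rewrite mulgA xK mul1g. Qed.

Lemma eq_mul_minv (x y z : A) : invertible x -> y * x = z -> y = z * minv x.
Proof. by move=> /minvP[xK _] <-; rewrite -mulgA xK mulg1. Qed.
End Units.

Theorem lemma17 (G : groupType) (k : fieldType)
    (H : quasitriangular_hopf_pi_coalgebra G k) (a b : G) :
  (* (a) *)
  (invertible (drinfeld H a) /\
   minv (drinfeld H a) =
     amul_map (H a) (tmap idfun (antipV H a \o antip H a) (tflip (Rmx H a a))))
  /\
  (* (b) *)
  (forall x : H a,
    antipV H a (antip H a (crossing_to H (conj_self a) x)) =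
      (drinfeld H a * x * minv (drinfeld H a))%g)
  /\
  (* (c) *)
  bijective (antip H a)
  /\
  (* (d) *)
  crossing H b a (drinfeld H a) = drinfeld H (b * a * b^-1)%g
  /\
  (* (e) *)
  (let c := (antipV H a (drinfeld H a^-1%g) * drinfeld H a)%g in
   c = (drinfeld H a * antipV H a (drinfeld H a^-1%g))%g /\
   forall x : H a,
     (c * crossing_to H (conj_selfV a) x)%g =
     (crossing_to H (conj_self a) x * c)%g)
  /\
  (* (f) *)
  (let P := (tflip (tmap idfun (crossing_to H (conj_self a)) (Rmx H b a)) *
             Rmx H a b)%g in
   let Q := (tflip (tmap (crossing_to H (conj_selfV b)) idfun (Rmx H b a)) *
             tmap (crossing_to H (conj_selfV a)) (crossing_to H (conj_selfV b))
               (Rmx H a b))%g in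
   [/\ invertible P,
       invertible Q,
       Delta H a b (drinfeld H (a * b)%g) =
         (minv P * tens (drinfeld H a) (drinfeld H b))%g &
       Delta H a b (drinfeld H (a * b)%g) =
         (tens (drinfeld H a) (drinfeld H b) * minv Q)%g])
  /\
  (* (g) *)
  eps H (drinfeld H 1%g) = 1.
Proof.
have uV := drinfeld_inverse H a.
have uI : invertible (drinfeld H a) by exists (drinfeld_inv H a).
have minv_u : minv (drinfeld H a) = drinfeld_inv H a by exact: minvE.
split; first by split; rewrite // minv_u drinfeld_invE.
split; first by move=> x; rewrite minv_u cross_to -antipode_antip
  -antipode_antipV antipode2_conj.
split; first exact: antip_bij.
split; first by rewrite cross_crossing cross_drinfeld.
split.
  split; first by rewrite -antipode_antipV drinfeld_antipode_comm.
  by move=> x; rewrite !cross_to -antipode_antipV drinfeld_antipode_cross.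
split; last exact: eps_drinfeld.
move=> P Q.
have PE : P = (R21 H a b * Rmx H a b)%g.
  rewrite /P; congr (_ * _)%g; rewrite -[in LHS](sw_tens (Rmx H b a)).
  rewrite (sw_lin _ _ (g := fun t => tflip (tmap _ _ t))); last by lin.
  by apply: sw_eq => p q; rewrite tmapE tflipE cross_to.
have QE : Q = Qmx H a b.
  rewrite /Q; congr (_ * _)%g.
    rewrite -[in LHS](sw_tens (Rmx H b a)).
    rewrite (sw_lin _ _ (g := fun t => tflip (tmap _ _ t))); last by lin.
    by apply: sw_eq => p q; rewrite tmapE tflipE cross_to.
  rewrite -[in LHS](sw_tens (Rmx H a b)).
  rewrite (sw_lin _ _ (g := fun t => tmap _ _ t)); last by lin.
  by apply: sw_eq => p q; rewrite tmapE !cross_to.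
have PI : invertible P.
  by rewrite PE; apply: invertibleM; [exact: R21_inverse|exact: Rmx_invertible].
pose U := tens (drinfeld H a) (drinfeld H b).
pose V := tens (drinfeld_inv H a) (drinfeld_inv H b).
have UV : (U * V = 1)%g /\ (V * U = 1)%g.
  have [uv' vu'] := drinfeld_inverse H b; case: uV => uv vu.
  by rewrite /U /V !tens_mulE uv vu uv' vu'.
(* Q is thus a conjugate of P: it inherits invertibility, and the second coproduct formula follows
   from the first. *)
have UQ : (U * Q = P * U)%g by rewrite QE PE; exact: Qmx_conj.
have QI : invertible Q.
  have -> : Q = (V * (P * U))%g by rewrite -UQ mulgA UV.2 mul1g.
  apply: invertibleM; first by exists U; case: UV.
  by apply: invertibleM; last by exists V.
have DU : Delta H a b (drinfeld H (a * b)%g) = (minv P * U)%g.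
  by apply: eq_minv_mul => //; rewrite PE -comulE comul_drinfeld.
split=> //; rewrite DU; apply: eq_mul_minv => //.
by have [_ PK] := minvP PI; rewrite -mulgA UQ mulgA PK mul1g.
Qed.
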